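(* Let $p>3$ be a prime number. Let $(A,+,\circ)$ be an $\mathbb F_p$-brace which is not right nilpotent and whose multiplicative group $(A,\circ)$ is (isomorphic to) the group XV. Then there exist $i,k,y\in\mathbb F_p$ with $y\neq 0$ such that $A$ is isomorphic to the brace $A_{i,k,y}$ constructed in the context.
   Context: A (left) brace is a set $A$ with operations $+,\circ$ such that $(A,+)$ is an abelian group, $(A,\circ)$ is a group (the multiplicative group), and $a\circ(b+c)+a=a\circ b+a\circ c$ for all $a,b,c\in A$. Put $a*b=a\circ b-a-b$. An $\mathbb F_p$-brace is a left brace whose additive group is an $\mathbb F_p$-vector space with $a*(\alpha b)=\alpha(a*b)$ for all $a,b\in A$, $\alpha\in\mathbb F_p$. Put $A^{(1)}=A$ and let $A^{(n+1)}=A^{(n)}*A$ be the set of sums of elements $a*b$ with $a\in A^{(n)}$, $b\in A$; $A$ is right nilpotent if $A^{(n)}=0$ for some $n$. Group XV is the group $(G,\circ)$ of order $p^4$ generated by $P,Q,R,S$ subject to the relations $Q\circ S=S\circ Q\circ P$, $Q\circ R=R\circ Q$, $P\circ S=S\circ P$, $P\circ Q=Q\circ P$, $P\circ R=R\circ P$, $R\circ S=S\circ R\circ Q$, $P^p=Q^p=R^p=S^p=1_G$. Construction of $A_{i,k,y}$ (for $i,k,y\in\mathbb F_p$, $y\ne0$). Let $B'$ be the $\mathbb F_p$-vector space with basis $\mathbf 1,R',Q',P',S'$ and $B=\mathbb F_pP'+\mathbb F_pQ'+\mathbb F_pR'+\mathbb F_pS'\subset B'$. Define linear maps $\lambda_P,\lambda_Q,\lambda_R,\lambda_S:B'\to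 B'$ by $\lambda_g(\mathbf 1)=g'+\mathbf 1$ for $g\in\{P,Q,R,S\}$ and - $\lambda_P(P')=P'$, $\lambda_P(Q')=Q'$, $\lambda_P(R')=R'+yS'$, $\lambda_P(S')=S'$; - $\lambda_Q(P')=P'$, $\lambda_Q(Q')=Q'-yS'$, $\lambda_Q(R')=R'+2^{-1}yS'$, $\lambda_Q(S')=S'$; - $\lambda_R(P')=P'+yS'$, $\lambda_R(Q')=Q'+2^{-1}yS'$, $\lambda_R(R')=R'+iP'+kS'$, $\lambda_R(S')=S'$; - $\lambda_S(P')=P'$, $\lambda_S(Q')=Q'-P'$, $\lambda_S(R')=R'-Q'+P'-2^{-1}yS'$, $\lambda_S(S')=S'$. These maps satisfy the defining relations of $G$, so they extend to automorphisms $\lambda_g$ of $B'$ for all $g\in G$ with $\lambda_{g\circ h}=\lambda_g\lambda_h$. The map $f:G\to B$, $f(g)=\lambda_g(\mathbf 1)-\mathbf 1$, is a bijection. The brace $A_{i,k,y}$ is $(G,+,\circ)$, where $\circ$ is the group operation of $G$ and $g+h=f^{-1}(f(g)+f(h))$. *)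

(* Defs.v *)
From HB Require Import structures.
From mathcomp Require Import all_boot all_order all_algebra all_fingroup.
From mathcomp Require Import all_solvable.
From mathcomp Require Import ring.

Set Implicit Arguments.
Unset Strict Implicit.
Unset Printing Implicit Defensive.

Import GRing.Theory.
Local Open Scope ring_scope.

Reserved Notation "a ∘ b" (at level 40, left associativity).
Reserved Notation "a ⋆ b" (at level 40, left associativity).

(* The multiplicative group of a brace is its MathComp [groupType] structure,
   whose product is written ∘ to keep it apart from ring multiplication. *)
Notation "a ∘ b" := (a * b)%g : ring_scope.

HB.mixin Record isLeftBrace A of GRing.Zmodule A & monoid.Group A := {
  braceDr : forall a b c : A, a ∘ (b + c) + a = a ∘ b + a ∘ c
}.

#[short(type="leftBraceType")]
HB.structure Definition LeftBrace :=
  { A of GRing.Zmodule A & monoid.Group A & isLeftBrace A }.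

Definition brace_star (A : leftBraceType) (a b : A) : A := a ∘ b - a - b.

Notation "a ⋆ b" := (brace_star a b) : ring_scope.

HB.mixin Record LeftBrace_isFpBrace (p : nat) A
    of LeftBrace A & GRing.Lmodule 'F_p A := {
  brace_starZr : forall (c : 'F_p) (a b : A), a ⋆ (c *: b) = c *: (a ⋆ b)
}.

#[short(type="fpBraceType")]
HB.structure Definition FpBrace (p : nat) :=
  { A of LeftBrace A & GRing.Lmodule 'F_p A & LeftBrace_isFpBrace p A }.

(* [right_series A n] is A^(n+1), where A^(1) = A. *)
Fixpoint right_series (A : leftBraceType) (n : nat) : A -> Prop :=
  match n with
  | 0 => fun _ => True
  | m.+1 => fun x => exists s : seq (A * A),
      (forall ab, ab \in s -> right_series m ab.1) /\
      x = \sum_(ab <- s) ab.1 ⋆ ab.2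
  end.

Definition right_nilpotent (A : leftBraceType) : Prop :=
  exists n : nat, forall x : A, right_series n x -> x = 0.

Definition group_isomorphic (G H : groupType) : Prop :=
  exists phi : G -> H, bijective phi /\ {morph phi : a b / a ∘ b}.

Definition brace_isomorphic (A B : leftBraceType) : Prop :=
  exists phi : A -> B,
    [/\ bijective phi, {morph phi : a b / a + b} & {morph phi : a b / a ∘ b}].

Local Open Scope group_scope.

(* The defining relations of group XV. *)
Record XV_relations (p : nat) (T : monoidType) (P Q R S : T) : Prop := {
  rel_QS : Q * S = S * Q * P;
  rel_QR : Q * R = R * Q;
  rel_PS : P * S = S * P;
  rel_PQ : P * Q = Q * P;
  rel_PR : P * R = R * P;
  rel_RS : R * S = S * R * Q;
  rel_Pp : P ^+ p = 1;
  rel_Qp : Q ^+ p = 1;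
  rel_Rp : R ^+ p = 1;
  rel_Sp : S ^+ p = 1
}.

(* Group XV with its distinguished generators; see [XV_presentation] and
   [groupXV_exists] below. *)
Record groupXV (p : nat) := GroupXV {
  XV_sort :> finGroupType;
  XV_P : XV_sort;
  XV_Q : XV_sort;
  XV_R : XV_sort;
  XV_S : XV_sort;
  XV_card : #|XV_sort| = (p ^ 4)%N;
  XV_gen : <<[set XV_P; XV_Q; XV_R; XV_S]>> = [set: XV_sort];
  XV_rel : XV_relations p XV_P XV_Q XV_R XV_S
}.

Arguments XV_P {p}.
Arguments XV_Q {p}.
Arguments XV_R {p}.
Arguments XV_S {p}.

(* Every element of XV is S^a R^b Q^c P^d for unique 0 <= a, b, c, d < p; the
   multiplication rule of these normal forms holds in every monoid satisfying
   the relations, which is how homomorphisms out of XV are obtained. *)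
Section NormalForm.
Variables (T : monoidType) (n : nat) (P Q R S : T).
Hypothesis rels : XV_relations n P Q R S.

Let QS := rel_QS rels. Let QR : commute Q R := rel_QR rels.
Let PS : commute P S := rel_PS rels. Let PQ : commute P Q := rel_PQ rels.
Let PR : commute P R := rel_PR rels. Let RS := rel_RS rels.

Definition normal_form (a b c d : nat) : T :=
  S ^+ a * R ^+ b * Q ^+ c * P ^+ d.

Let slideX (x s w : T) (c : nat) : x * s = s * w -> x ^+ c * s = s * w ^+ c.
Proof.
move=> xs; elim: c => [|c IH]; first by rewrite !expg0 mul1g mulg1.
by rewrite expgSr -mulgA xs mulgA IH -mulgA -expgSr.
Qed.

Let QSX a c : Q ^+ c * S ^+ a = S ^+ a * (Q ^+ c * P ^+ (c * a)).
Proof.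
have Q1 a' : Q * S ^+ a' = S ^+ a' * (Q * P ^+ a').
  elim: a' => [|m IH]; first by rewrite !expg0 mul1g !mulg1.
  rewrite [in LHS]expgSr mulgA IH -!mulgA.
  rewrite -(commuteX m (commute_sym PS)) (mulgA Q) QS -!mulgA -expgS.
  by rewrite mulgA -expgSr.
rewrite (slideX _ (Q1 a)) expgMn; last exact/commuteX/commute_sym.
by rewrite -expgnA [(a * c)%N]mulnC.
Qed.

Let RSX a b : R ^+ b * S ^+ a =
  S ^+ a * (R ^+ b * (Q ^+ (b * a) * P ^+ (b * 'C(a, 2)))).
Proof.
have R1 a' : R * S ^+ a' = S ^+ a' * (R * (Q ^+ a' * P ^+ 'C(a', 2))).
  elim: a' => [|m IH]; first by rewrite !expg0 mul1g !mulg1.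
  rewrite [in LHS]expgSr mulgA IH -!mulgA.
  rewrite -(commuteX 'C(m, 2) (commute_sym PS)) (mulgA (Q ^+ m)).
  have := QSX 1 m; rewrite expg1 muln1 => ->.
  rewrite -!mulgA (mulgA R) RS -!mulgA -expgnDr (mulgA Q) -expgS.
  by rewrite (mulgA (S ^+ m)) -expgSr binS bin1 addnC.
have cQP m n' : commute (Q ^+ m) (P ^+ n') by exact/commuteX2/commute_sym.
have cRQ : commute R Q by exact/commute_sym.
have cRP : commute R P by exact/commute_sym.
rewrite (slideX _ (R1 a)) !expgMn //; last first.
  by apply: commuteM; apply: commuteX.
by rewrite -!expgnA [(a * b)%N]mulnC [('C(a, 2) * b)%N]mulnC.
Qed.

Lemma normal_formM a b c d a' b' c' d' :
  normal_form a b c d * normal_form a' b' c' d' =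
  normal_form (a + a') (b + b') (c + c' + b * a')
              (d + d' + c * a' + b * 'C(a', 2)).
Proof.
rewrite /normal_form.
have rQS i j z : Q ^+ i * (S ^+ j * z) =
    S ^+ j * (Q ^+ i * (P ^+ (i * j) * z)) by rewrite mulgA QSX -!mulgA.
have rRS i j z : R ^+ i * (S ^+ j * z) =
    S ^+ j * (R ^+ i * (Q ^+ (i * j) * (P ^+ (i * 'C(j, 2)) * z))).
  by rewrite mulgA RSX -!mulgA.
have rc (x y : T) i j z : commute x y ->
  x ^+ i * (y ^+ j * z) = y ^+ j * (x ^+ i * z).
  by move=> cxy; rewrite mulgA (commuteX2 i j cxy) -mulgA.
have rPS i j z := rc _ _ i j z PS; have rPR i j z := rc _ _ i j z PR.
have rPQ i j z := rc _ _ i j z PQ; have rQR i j z := rc _ _ i j z QR.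
have rX (x : T) i j z : x ^+ i * (x ^+ j * z) = x ^+ (i + j) * z.
  by rewrite mulgA -expgnDr.
rewrite -[X in _ * X = _]mulg1 -[X in _ = X]mulg1 -!mulgA.
rewrite !(rPS, rQS, rRS); rewrite !(rPR, rQR); rewrite !rPQ; rewrite !rX.
by congr (_ * (_ * (_ ^+ _ * (_ ^+ _ * _)))); rewrite ?mulg1 //; ring.
Qed.

Lemma normal_form_mod a b c d :
  normal_form (a %% n) (b %% n) (c %% n) (d %% n) = normal_form a b c d.
Proof.
have Xmod (x : T) m : x ^+ n = 1 -> x ^+ (m %% n) = x ^+ m.
  by move=> xn; rewrite {2}(divn_eq m n) expgnDr mulnC expgnA xn expg1n mul1g.
by case: rels => *; rewrite /normal_form !Xmod.
Qed.

Lemma normal_form0 : normal_form 0 0 0 0 = 1.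
Proof. by rewrite /normal_form !expg0 !mulg1. Qed.

Lemma normal_formP : normal_form 0 0 0 1 = P.
Proof. by rewrite /normal_form !expg0 !mul1g. Qed.

Lemma normal_formQ : normal_form 0 0 1 0 = Q.
Proof. by rewrite /normal_form !expg0 !mul1g mulg1. Qed.

Lemma normal_formR : normal_form 0 1 0 0 = R.
Proof. by rewrite /normal_form !expg0 mul1g !mulg1. Qed.

Lemma normal_formS : normal_form 1 0 0 0 = S.
Proof. by rewrite /normal_form !expg0 !mulg1. Qed.

End NormalForm.

Section XVHomomorphisms.
Variables (p : nat) (p_gt0 : (0 < p)%N) (G : groupXV p).

Local Notation nf := (normal_form (XV_P G) (XV_Q G) (XV_R G) (XV_S G)).

Let nfI (x : 'I_p * 'I_p * 'I_p * 'I_p) : G := nf x.1.1.1 x.1.1.2 x.1.2 x.2.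

Lemma nfI_onto (g : G) : g \in codom nfI.
Proof.
have nf_in a b c d : nf a b c d \in codom nfI.
  have lt m : (m %% p < p)%N by rewrite ltn_mod.
  rewrite -(normal_form_mod (XV_rel G)).
  apply/codomP; exists (Ordinal (lt a), Ordinal (lt b), Ordinal (lt c), Ordinal (lt d)).
  by [].
have gr : group_set [set g | g \in codom nfI].
  apply/group_setP; split; first by rewrite inE -(normal_form0 (XV_P G) (XV_Q G) (XV_R G) (XV_S G)).
  move=> x z; rewrite !inE => /codomP[u ->] /codomP[v ->].
  by rewrite /nfI (normal_formM (XV_rel G)).
have: g \in <<[set XV_P G; XV_Q G; XV_R G; XV_S G]>> by rewrite XV_gen inE.
suff /subsetP sub : <<[set XV_P G; XV_Q G; XV_R G; XV_S G]>> \subset Group gr.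
  by move/sub; rewrite inE.
rewrite gen_subG; apply/subsetP => x; rewrite !inE.
case/orP=> [/orP[/orP[]|]|] /eqP->.
- by rewrite -[X in X \in _](normal_formP (XV_P G) (XV_Q G) (XV_R G) (XV_S G)).
- by rewrite -[X in X \in _](normal_formQ (XV_P G) (XV_Q G) (XV_R G) (XV_S G)).
- by rewrite -[X in X \in _](normal_formR (XV_P G) (XV_Q G) (XV_R G) (XV_S G)).
by rewrite -[X in X \in _](normal_formS (XV_P G) (XV_Q G) (XV_R G) (XV_S G)).
Qed.

Lemma XV_normal_form (g : G) : exists a b c d,
  [/\ (a < p)%N, (b < p)%N, (c < p)%N, (d < p)%N & g = nf a b c d].
Proof.
have /codomP[[[[a b] c] d] ->] := nfI_onto g.
by exists a, b, c, d; split.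
Qed.

Let nfI_inj : injective nfI.
Proof.
apply/injectiveP/card_uniqP; rewrite size_codom !card_prod !card_ord.
have -> : (p * p * p * p = p ^ 4)%N by rewrite !expnS expn0 muln1 !mulnA.
rewrite -(XV_card G); apply/eqP; rewrite eqn_leq max_card andTb.
 apply/subset_leq_card/subsetP => g _; apply: nfI_onto.
Qed.

Variables (T : monoidType) (P Q R S : T).
Hypothesis rels : XV_relations p P Q R S.

Local Notation nfT := (normal_form P Q R S).

Lemma XV_hom_sig : {l : G -> T | {morph l : g h / g * h} &
  forall a b c d, l (nf a b c d) = nfT a b c d}.
Proof.
pose dec g := iinv (nfI_onto g).
pose l g := let x := dec g in nfT x.1.1.1 x.1.1.2 x.1.2 x.2.
have lnf a b c d : l (nf a b c d) = nfT a b c d.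
  have lt m : (m %% p < p)%N by rewrite ltn_mod.
  pose x := (Ordinal (lt a), Ordinal (lt b), Ordinal (lt c), Ordinal (lt d)).
  have decE : dec (nf a b c d) = x.
    by apply: nfI_inj; rewrite /dec f_iinv -(normal_form_mod (XV_rel G)).
  by rewrite /l decE /= (normal_form_mod rels).
exists l => // g h.
have [a [b [c [d [_ _ _ _ ->]]]]] := XV_normal_form g.
have [a' [b' [c' [d' [_ _ _ _ ->]]]]] := XV_normal_form h.
by rewrite (normal_formM (XV_rel G)) !lnf (normal_formM rels).
Qed.

End XVHomomorphisms.

(* The multiplicative monoid of a ring. *)
Definition mulmon (R : pzRingType) : Type := R.
HB.instance Definition _ (R : pzRingType) := Choice.on (mulmon R).
HB.instance Definition _ (R : pzRingType) :=
  isMonoid.Build (mulmon R) (@mulrA R) (@mul1r R) (@mulr1 R).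

Lemma mulmonX (R : pzRingType) (x : R) n : ((x : mulmon R) ^+ n)%g = (x ^+ n)%R.
Proof. by elim: n => // n IH; rewrite expgS IH exprS. Qed.

Local Close Scope group_scope.

Lemma sum_ord5 (V : nmodType) (F : 'I_5 -> V) :
  \sum_i F i = F 0 + F 1 + F 2 + F 3 + F 4.
Proof.
rewrite !big_ord_recl big_ord0 addr0 !addrA.
by do ![congr (_ + _)]; congr F; apply: val_inj.
Qed.

Section Matrices.
Variables (p : nat) (i k y : 'F_p).

(* B' is realised as 'cV_5, the basis being listed in the order
   1, R', Q', P', S'; linear maps act on the left as matrices. *)
Definition bas1 : 'cV['F_p]_5 := delta_mx 0 0.
Definition basR : 'cV['F_p]_5 := delta_mx 1 0.
Definition basQ : 'cV['F_p]_5 := delta_mx 2 0.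
Definition basP : 'cV['F_p]_5 := delta_mx 3 0.
Definition basS : 'cV['F_p]_5 := delta_mx 4 0.

(* The linear map sending 1, R', Q', P', S' to v1, vR, vQ, vP, vS. *)
Definition lin_of_images (v1 vR vQ vP vS : 'cV['F_p]_5) : 'M['F_p]_5 :=
  \matrix_(r, c) (nth 0 [:: v1; vR; vQ; vP; vS] c) r 0.

Definition lamP : 'M['F_p]_5 :=
  lin_of_images (basP + bas1) (basR + y *: basS) basQ basP basS.
Definition lamQ : 'M['F_p]_5 :=
  lin_of_images (basQ + bas1) (basR + (2^-1 * y) *: basS) (basQ - y *: basS)
                basP basS.
Definition lamR : 'M['F_p]_5 :=
  lin_of_images (basR + bas1) (basR + i *: basP + k *: basS)
                (basQ + (2^-1 * y) *: basS) (basP + y *: basS) basS.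
Definition lamS : 'M['F_p]_5 :=
  lin_of_images (basS + bas1) (basR - basQ + basP - (2^-1 * y) *: basS)
                (basQ - basP) basP basS.

Lemma lin_of_imagesE v1 vR vQ vP vS v :
  lin_of_images v1 vR vQ vP vS *m v = v 0 0 *: v1 + v 1 0 *: vR + v 2 0 *: vQ
    + v 3 0 *: vP + v 4 0 *: vS.
Proof.
apply/colP => r; rewrite !mxE sum_ord5 !mxE /=.
by rewrite ![v _ _ * _]mulrC.
Qed.

Let vec5 (a b c d e : 'F_p) : 'cV_5 := \col_r nth 0 [:: a; b; c; d; e] r.

Let vec5P (v : 'cV_5) : v = vec5 (v 0 0) (v 1 0) (v 2 0) (v 3 0) (v 4 0).
Proof.
apply/colP => r; rewrite mxE; case: r => [[|[|[|[|[|//]]]]] lt] /=;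
  by congr (v _ _); apply: val_inj.
Qed.

Let vec5E : (bas1 = vec5 1 0 0 0 0) * (basR = vec5 0 1 0 0 0) *
  (basQ = vec5 0 0 1 0 0) * (basP = vec5 0 0 0 1 0) * (basS = vec5 0 0 0 0 1).
Proof.
by do ![split]; apply/colP => r; rewrite !mxE;
  case: r => [[|[|[|[|[|//]]]]] lt].
Qed.

Let vec5D a b c d e a' b' c' d' e' :
  vec5 a b c d e + vec5 a' b' c' d' e' =
  vec5 (a + a') (b + b') (c + c') (d + d') (e + e').
Proof.
by apply/colP => r; rewrite !mxE; case: r => [[|[|[|[|[|//]]]]] lt].
Qed.

Let vec5N a b c d e : - vec5 a b c d e = vec5 (- a) (- b) (- c) (- d) (- e).
Proof.
by apply/colP => r; rewrite !mxE; case: r => [[|[|[|[|[|//]]]]] lt].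
Qed.

Let vec5Z z a b c d e :
  z *: vec5 a b c d e = vec5 (z * a) (z * b) (z * c) (z * d) (z * e).
Proof.
by apply/colP => r; rewrite !mxE; case: r => [[|[|[|[|[|//]]]]] lt].
Qed.

Let vec5_coord a b c d e (v := vec5 a b c d e) :
  (v 0 0 = a) * (v 1 0 = b) * (v 2 0 = c) * (v 3 0 = d) * (v 4 0 = e).
Proof. by rewrite /v !mxE. Qed.

Let lin5 := (lin_of_imagesE, vec5E, vec5D, vec5N, vec5Z, vec5_coord).

Let lamP_vec a b c d e :
  lamP *m vec5 a b c d e = vec5 a b c (d + a) (e + y * b).
Proof. by rewrite /lamP !lin5; congr vec5; ring. Qed.

Let lamQ_vec a b c d e :
  lamQ *m vec5 a b c d e = vec5 a b (c + a) d (e + 2^-1 * y * b - y * c).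
Proof. by rewrite /lamQ !lin5; congr vec5; ring. Qed.

Let lamR_vec a b c d e : lamR *m vec5 a b c d e =
  vec5 a (b + a) c (d + i * b) (e + k * b + 2^-1 * y * c + y * d).
Proof. by rewrite /lamR !lin5; congr vec5; ring. Qed.

Let lamS_vec a b c d e : lamS *m vec5 a b c d e =
  vec5 a b (c - b) (d + b - c) (e + a - 2^-1 * y * b).
Proof. by rewrite /lamS !lin5; congr vec5; ring. Qed.

Let lam_vec := (lamP_vec, lamQ_vec, lamR_vec, lamS_vec).

Let eq_mx_vec (A B : 'M['F_p]_5) :
  (forall a b c d e, A *m vec5 a b c d e = B *m vec5 a b c d e) -> A = B.
Proof.
move=> eqAB; apply/matrixP => r c; have := eqAB.
have E : A *m delta_mx c (0 : 'I_1) = B *m delta_mx c 0 by rewrite [delta_mx _ _]vec5P.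
by move=> _; have /colP/(_ r) := E; rewrite -!colE !mxE.
Qed.

Section PrimeGt3.
Hypotheses (p_pr : prime p) (p_gt3 : (3 < p)%N).

Let two_neq0 : (2 : 'F_p) != 0.
Proof.
rewrite -[2]/(2%:R) -(dvdn_pcharf (pchar_Fp p_pr)) gtnNdvd //.
by apply: leq_trans p_gt3.
Qed.

Let unip (A : 'M['F_p]_5) : (A - 1) ^+ 5 = 0 -> A ^+ p = 1.
Proof.
move=> nil; have p_gt4 : (4 < p)%N.
  by rewrite ltn_neqAle p_gt3 andbT; apply: contraTneq p_pr => <-.
have chM : p \in [pchar 'M['F_p]_5] by rewrite pchar_lalg pchar_Fp.
rewrite -[A](subrK 1) -(pFrobenius_autE chM) pFrobenius_autD_comm; last first.
  exact: commr1.
have nilX m : (4 < m)%N -> (A - 1) ^+ m = 0.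
  by move=> m_gt4; rewrite -(subnK m_gt4) exprD nil mulr0.
by rewrite pFrobenius_aut1 pFrobenius_autE nilX // add0r.
Qed.

Lemma lam_relations : XV_relations p (lamP : mulmon 'M['F_p]_5)
  (lamQ : mulmon 'M['F_p]_5) (lamR : mulmon 'M['F_p]_5)
  (lamS : mulmon 'M['F_p]_5).
Proof.
split; rewrite ?mulmonX; try
  (apply: eq_mx_vec => a b c d e; rewrite -!mulmxA !lam_vec;
   by congr vec5; first [ring | field]);
  apply: unip; apply: eq_mx_vec => a b c d e; rewrite mul0mx !exprS expr0 mulr1;
  rewrite -!mulmxA !mulmxBl !mul1mx; rewrite !(lam_vec, vec5N, vec5D);
  rewrite -[RHS](subrr (vec5 a b c d e)) vec5N vec5D; congr vec5; ring.
Qed.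

End PrimeGt3.

Let powP n d e : lamP ^+ n *m vec5 1 0 0 d e = vec5 1 0 0 (d + n%:R) e.
Proof.
elim: n => [|n IH]; first by rewrite expr0 mul1mx addr0.
by rewrite exprS -mulmxA IH lamP_vec; congr vec5; rewrite -?natr1; ring.
Qed.

Let powQ n c d e : exists e',
  lamQ ^+ n *m vec5 1 0 c d e = vec5 1 0 (c + n%:R) d e'.
Proof.
elim: n => [|n [e' IH]]; first by exists e; rewrite expr0 mul1mx addr0.
rewrite exprS -mulmxA IH lamQ_vec; eexists; congr vec5; rewrite -?natr1; ring.
Qed.

Let powR n b c d e : exists d' e',
  lamR ^+ n *m vec5 1 b c d e = vec5 1 (b + n%:R) c d' e'.
Proof.
elim: n => [|n [d' [e' IH]]].
  by exists d, e; rewrite expr0 mul1mx addr0.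
rewrite exprS -mulmxA IH lamR_vec; do 2!eexists.
by congr vec5; rewrite -?natr1; ring.
Qed.

Let powS n b c d e : exists c' d' e',
  lamS ^+ n *m vec5 1 b c d e = vec5 1 b c' d' e'.
Proof.
elim: n => [|n [c' [d' [e' IH]]]].
  by exists c, d, e; rewrite expr0 mul1mx.
by rewrite exprS -mulmxA IH lamS_vec; do 3!eexists.
Qed.

Let powS0 n c d e : exists d' e',
  lamS ^+ n *m vec5 1 0 c d e = vec5 1 0 c d' e'.
Proof.
elim: n => [|n [d' [e' IH]]].
  by exists d, e; rewrite expr0 mul1mx.
by rewrite exprS -mulmxA IH lamS_vec subr0; do 2!eexists.
Qed.

Let powS00 n d e :
  lamS ^+ n *m vec5 1 0 0 d e = vec5 1 0 0 d (e + n%:R).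
Proof.
elim: n => [|n IH]; first by rewrite expr0 mul1mx addr0.
by rewrite exprS -mulmxA IH lamS_vec; congr vec5; rewrite -?natr1; ring.
Qed.

Let vec5_inj a b c d e a' b' c' d' e' :
  vec5 a b c d e = vec5 a' b' c' d' e' ->
  [/\ a = a', b = b', c = c', d = d' & e = e'].
Proof.
by move=> /colP E; split; [have := E 0|have := E 1|have := E 2|have := E 3|
  have := E 4]; rewrite !mxE.
Qed.

Lemma lam_normal_form_coord0 a b c d :
  (lamS ^+ a *m lamR ^+ b *m lamQ ^+ c *m lamP ^+ d *m bas1) 0 0 = 1.
Proof.
rewrite vec5E -!mulmxA powP; have [e1 ->] := powQ c 0 (0 + d%:R) 0.
have [d2 [e2 ->]] := powR b 0 (0 + c%:R) (0 + d%:R) e1.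
by have [c3 [d3 [e3 ->]]] := powS a (0 + b%:R) (0 + c%:R) d2 e2; rewrite mxE.
Qed.

Lemma lam_normal_form_stab a b c d : prime p ->
  (a < p)%N -> (b < p)%N -> (c < p)%N -> (d < p)%N ->
  lamS ^+ a *m lamR ^+ b *m lamQ ^+ c *m lamP ^+ d *m bas1 = bas1 ->
  [/\ a = 0%N, b = 0%N, c = 0%N & d = 0%N].
Proof.
move=> p_pr lta ltb ltc ltd.
have nat0 m : (m < p)%N -> 0 + m%:R = 0 :> 'F_p -> m = 0%N.
  move=> ltm /eqP; rewrite add0r -(dvdn_pcharf (pchar_Fp p_pr)).
  by case: m ltm => // m ltm; rewrite gtnNdvd.
rewrite vec5E -!mulmxA powP; have [e1 E1] := powQ c 0 (0 + d%:R) 0.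
have [d2 [e2 E2]] := powR b 0 (0 + c%:R) (0 + d%:R) e1.
have [c3 [d3 [e3 E3]]] := powS a (0 + b%:R) (0 + c%:R) d2 e2.
have [d4 [e4 E4]] := powS0 a (0 + c%:R) (0 + d%:R) e1 => H.
have b0 : b = 0%N.
  by move: (H); rewrite E1 E2 E3 => /vec5_inj[_ /(nat0 _ ltb)].
move: H; rewrite b0 expr0 mul1mx => H.
have c0 : c = 0%N.
  by move: (H); rewrite E1 E4 => /vec5_inj[_ _ /(nat0 _ ltc)].
move: H; rewrite c0 expr0 mul1mx powS00.
by move=> /vec5_inj[_ _ _ /(nat0 _ ltd) -> /(nat0 _ lta) ->].
Qed.

End Matrices.

Section Construction.
Variables (p : nat) (p_pr : prime p) (p_gt3 : (3 < p)%N) (G : groupXV p).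
Variables (i k y : 'F_p).

Definition lambda_spec (l : G -> 'M['F_p]_5) : Prop :=
  [/\ l 1%g = 1%:M, forall g h, l (g ∘ h) = l g *m l h
    & [/\ l (XV_P G) = lamP y, l (XV_Q G) = lamQ y,
          l (XV_R G) = lamR i k y & l (XV_S G) = lamS y]].

Lemma lambda_sig : {l : G -> 'M['F_p]_5 | lambda_spec l}.
Proof.
have [l lM lnf] := XV_hom_sig (prime_gt0 p_pr) G (lam_relations i k y p_pr p_gt3).
exists l; split=> //.
  by rewrite -(normal_form0 (XV_P G) (XV_Q G) (XV_R G) (XV_S G)) lnf normal_form0.
split.
- by rewrite -(normal_formP (XV_P G) (XV_Q G) (XV_R G) (XV_S G)) lnf normal_formP.
- by rewrite -(normal_formQ (XV_P G) (XV_Q G) (XV_R G) (XV_S G)) lnf normal_formQ.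
- by rewrite -(normal_formR (XV_P G) (XV_Q G) (XV_R G) (XV_S G)) lnf normal_formR.
by rewrite -(normal_formS (XV_P G) (XV_Q G) (XV_R G) (XV_S G)) lnf normal_formS.
Qed.

Lemma lambda_spec_nf l a b c d : lambda_spec l ->
  l (normal_form (XV_P G) (XV_Q G) (XV_R G) (XV_S G) a b c d) =
  lamS y ^+ a *m lamR i k y ^+ b *m lamQ y ^+ c *m lamP y ^+ d.
Proof.
move=> [l1 lM [lP lQ lR lS]].
have lX g m : l (g ^+ m)%g = l g ^+ m.
  by elim: m => [|m IH]; rewrite ?expg0 ?expr0 // expgS exprS lM IH.
by rewrite /normal_form !lM !lX lP lQ lR lS.
Qed.

Lemma lambda_unique l l' : lambda_spec l -> lambda_spec l' -> l =1 l'.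
Proof.
move=> sl sl' g.
have [a [b [c [d [_ _ _ _ ->]]]]] := XV_normal_form (prime_gt0 p_pr) g.
by rewrite (lambda_spec_nf _ _ _ _ sl) (lambda_spec_nf _ _ _ _ sl').
Qed.

(* The unique extension of the four maps on generators to a morphism from
   (G, ∘) to the linear automorphisms of B'. *)
Definition lambda : G -> 'M['F_p]_5 := sval lambda_sig.

Lemma lambdaP : lambda_spec lambda. Proof. exact: svalP lambda_sig. Qed.

Lemma lambda1 : lambda 1%g = 1%:M. Proof. by have [] := lambdaP. Qed.

Lemma lambdaM g h : lambda (g ∘ h) = lambda g *m lambda h.
Proof. by have [_ ->] := lambdaP. Qed.

Lemma lambda_unit g : lambda g \in unitmx.
Proof.
have: lambda g *m lambda g^-1%g = 1%:M by rewrite -lambdaM mulgV lambda1.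
by case/mulmx1_unit => gU _; exact: gU.
Qed.

Definition XV_B : {vspace 'cV['F_p]_5} :=
  (<[basP p]> + <[basQ p]> + <[basR p]> + <[basS p]>)%VS.

Lemma XV_BE v : (v \in XV_B) = (v 0 0 == 0).
Proof.
apply/idP/eqP => [|v0].
  case/memv_addP=> u /memv_addP[w /memv_addP[x /vlineP[a ->] [z /vlineP[b ->] ->]]].
  by case=> z' /vlineP[c ->] -> [z'' /vlineP[d ->] ->]; rewrite !mxE /= !mulr0 !addr0.
have -> : v = v 3 0 *: basP p + v 2 0 *: basQ p + v 1 0 *: basR p + v 4 0 *: basS p.
  apply/colP => r; rewrite !mxE; case: r => [[|[|[|[|[|//]]]]] lt] /=;
  rewrite ?mulr0 ?mulr1 ?addr0 ?add0r -?v0; congr (v _ _); exact: val_inj.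
by rewrite !memv_add // memvZ // memv_line.
Qed.

Definition XV_f (g : G) : 'cV['F_p]_5 := lambda g *m bas1 p - bas1 p.

Lemma XV_fM g h : XV_f (g ∘ h) = XV_f g + lambda g *m XV_f h.
Proof. by rewrite /XV_f lambdaM mulmxBr mulmxA [RHS]addrC addrA subrK. Qed.

Lemma XV_f1 : XV_f 1%g = 0.
Proof. by rewrite /XV_f lambda1 mul1mx subrr. Qed.

Lemma XV_f_in g : XV_f g \in XV_B.
Proof.
have [a [b [c [d [_ _ _ _ ->]]]]] := XV_normal_form (prime_gt0 p_pr) g.
rewrite XV_BE /XV_f (lambda_spec_nf _ _ _ _ lambdaP) mxE.
by rewrite lam_normal_form_coord0 !mxE subrr.
Qed.

Lemma XV_f_inj : injective XV_f.
Proof.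
move=> g h /addIr eq_gh.
suff: (h^-1 * g)%g = 1%g by move/(congr1 (mulg h)); rewrite mulKVg mulg1.
have: lambda (h^-1 * g)%g *m bas1 p = bas1 p.
  by rewrite lambdaM -mulmxA eq_gh mulmxA -lambdaM mulVg lambda1 mul1mx.
move: (h^-1 * g)%g => x {g h eq_gh}.
have [a [b [c [d [lta ltb ltc ltd ->]]]]] := XV_normal_form (prime_gt0 p_pr) x.
rewrite (lambda_spec_nf _ _ _ _ lambdaP).
move=> /(lam_normal_form_stab p_pr lta ltb ltc ltd) [-> -> -> ->].
by rewrite normal_form0.
Qed.

Lemma XV_f_onto v : v \in XV_B -> exists g, XV_f g = v.
Proof.
move=> vB; have: v \in [set x in XV_B] by rewrite inE.
suff <- : XV_f @: [set: G] = [set x in XV_B] by case/imsetP=> g _ ->; exists g.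
apply/eqP; rewrite eqEcard; apply/andP; split.
  by apply/subsetP => _ /imsetP[g _ ->]; rewrite inE XV_f_in.
rewrite (card_imset _ XV_f_inj) cardsT XV_card.
have -> : (p ^ 4 = #|'cV['F_p]_4|)%N by rewrite card_mx card_Fp.
apply: (leq_card_in (fun x : 'cV_5 => @dsubmx _ 1 4 1 x)) => x z.
rewrite !inE !XV_BE => /eqP x0 /eqP z0 eq_xz.
apply/colP => r; case: (unliftP 0 r) => [s ->|->]; last by rewrite x0 z0.
by have /colP/(_ s) := eq_xz; rewrite !mxE; congr (x _ _ = z _ _); apply: val_inj.
Qed.

#[local] Opaque XV_f.

Lemma XV_finv_sig :
  {finv : 'cV['F_p]_5 -> G | cancel XV_f finv & {in XV_B, cancel finv XV_f}}.
Proof.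
pose finv v : G := odflt 1%g [pick g | XV_f g == v].
have fK : cancel XV_f finv.
  move=> g; rewrite /finv; case: pickP => [h /eqP/XV_f_inj //|/(_ g)].
  by rewrite eqxx.
by exists finv => // v /XV_f_onto[g <-]; rewrite fK.
Qed.

(* f^-1 : B -> G, totalised by unspecified values outside B. *)
Definition XV_finv : 'cV['F_p]_5 -> G := s2val XV_finv_sig.

Lemma XV_fK : cancel XV_f XV_finv.
Proof. exact: (s2valP XV_finv_sig). Qed.

Lemma XV_finvK : {in XV_B, cancel XV_finv XV_f}.
Proof. exact: (s2valP' XV_finv_sig). Qed.

Definition XV_add (g h : G) : G := XV_finv (XV_f g + XV_f h).
Definition XV_opp (g : G) : G := XV_finv (- XV_f g).

Lemma XV_f_add g h : XV_f (XV_add g h) = XV_f g + XV_f h.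
Proof. by rewrite XV_finvK // memvD // XV_f_in. Qed.

Lemma XV_f_opp g : XV_f (XV_opp g) = - XV_f g.
Proof. by rewrite XV_finvK // memvN XV_f_in. Qed.

#[local] Opaque XV_add XV_opp.

Lemma XV_addA : associative XV_add.
Proof. by move=> g h l; apply: XV_f_inj; rewrite !XV_f_add addrA. Qed.

Lemma XV_addC : commutative XV_add.
Proof. by move=> g h; apply: XV_f_inj; rewrite !XV_f_add addrC. Qed.

Lemma XV_add1g : left_id 1%g XV_add.
Proof. by move=> g; apply: XV_f_inj; rewrite XV_f_add XV_f1 add0r. Qed.

Lemma XV_addNg : left_inverse 1%g XV_opp XV_add.
Proof.
by move=> g; apply: XV_f_inj; rewrite XV_f_add XV_f_opp addNr XV_f1.
Qed.

Lemma XV_braceDr g h l :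
  XV_add (g ∘ XV_add h l) g = XV_add (g ∘ h) (g ∘ l).
Proof.
apply: XV_f_inj; rewrite !(XV_f_add, XV_fM) mulmxDr.
by rewrite addrAC [RHS]addrACA.
Qed.

End Construction.

(* The set G with + transported along f and the group law of G as ∘. *)
Definition brace_XV (p : nat) (p_pr : prime p) (p_gt3 : (3 < p)%N)
  (G : groupXV p) (i k y : 'F_p) : Type := G.

Section BraceXV.
Variables (p : nat) (p_pr : prime p) (p_gt3 : (3 < p)%N) (G : groupXV p).
Variables (i k y : 'F_p).

Local Notation A := (brace_XV p_pr p_gt3 G i k y).

HB.instance Definition _ := monoid.Group.copy A (XV_sort G).
HB.instance Definition _ := GRing.isZmodule.Build A
  (@XV_addA _ p_pr p_gt3 G i k y) (@XV_addC _ p_pr p_gt3 G i k y)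
  (@XV_add1g _ p_pr p_gt3 G i k y) (@XV_addNg _ p_pr p_gt3 G i k y).
HB.instance Definition _ := isLeftBrace.Build A
  (@XV_braceDr _ p_pr p_gt3 G i k y).

Lemma brace_XV_addE (g h : A) :
  g + h = XV_finv p_pr p_gt3 G i k y
            (XV_f p_pr p_gt3 i k y (g : G) + XV_f p_pr p_gt3 i k y (h : G)).
Proof. by []. Qed.

Lemma brace_XV_mulE (g h : A) : g ∘ h = ((g : G) * (h : G))%g.
Proof. by []. Qed.

End BraceXV.

Local Open Scope group_scope.

Lemma XV_presentation (p : nat) (G : groupXV p) : (0 < p)%N ->
  [set: G] \isog Grp (P : Q : R : S :
    Q * S = S * Q * P, Q * R = R * Q, P * S = S * P, P * Q = Q * P,
    P * R = R * P, R * S = S * R * Q,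
    P ^+ p = 1, Q ^+ p = 1, R ^+ p = 1, S ^+ p = 1).
Proof.
move=> p_gt0; apply: intro_isoGrp.
  apply/existsP; exists (XV_P G, XV_Q G, XV_R G, XV_S G) => /=.
  rewrite !xpair_eqE /=; case: (XV_rel G) => /= *.
  apply/and5P; split; try exact/eqP.
    rewrite eqEsubset subsetT -(XV_gen G) gen_subG !subUset !sub1set.
    have P1 : XV_P G \in <[XV_P G]> <*> <[XV_Q G]> <*> <[XV_R G]> <*> <[XV_S G]>.
      by do 3![apply/(subsetP (joing_subl _ _))]; apply: cycle_id.
    have Q1 : XV_Q G \in <[XV_P G]> <*> <[XV_Q G]> <*> <[XV_R G]> <*> <[XV_S G]>.
      do 2![apply/(subsetP (joing_subl _ _))].
      by apply/(subsetP (joing_subr _ _)); apply: cycle_id.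
    have R1 : XV_R G \in <[XV_P G]> <*> <[XV_Q G]> <*> <[XV_R G]> <*> <[XV_S G]>.
      apply/(subsetP (joing_subl _ _)).
      by apply/(subsetP (joing_subr _ _)); apply: cycle_id.
    by rewrite P1 Q1 R1; apply/(subsetP (joing_subr _ _)); apply: cycle_id.
  by do ![apply/andP; split; try exact/eqP].
move=> rT H /existsP[[[[P Q] R] S]] /=; rewrite !xpair_eqE /=.
case/andP=> /eqP defH; do 9![case/andP => /eqP ?]; move=> /eqP ?.
have rels : XV_relations p P Q R S by split.
have [l lM lnf] := XV_hom_sig p_gt0 G rels.
have lM' : {in [set: G] &, {morph l : x y / x * y}} by move=> x y _ _; apply: lM.
apply/homgP; exists (Morphism lM').
rewrite -[RHS]defH; apply/eqP; rewrite eqEsubset; apply/andP; split.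
  apply/subsetP => _ /morphimP[g _ _ ->] /=.
  have [a [b [c [d [_ _ _ _ ->]]]]] := XV_normal_form p_gt0 g.
  rewrite lnf /normal_form !groupM // groupX //.
  - by apply/(subsetP (joing_subr _ _)); apply: cycle_id.
  - apply/(subsetP (joing_subl _ _)).
    by apply/(subsetP (joing_subr _ _)); apply: cycle_id.
  - do 2![apply/(subsetP (joing_subl _ _))].
    by apply/(subsetP (joing_subr _ _)); apply: cycle_id.
  by do 3![apply/(subsetP (joing_subl _ _))]; apply: cycle_id.
rewrite !join_subG !cycle_subG /=.
have im a b c d : normal_form P Q R S a b c d \in Morphism lM' @* [set: G].
  by rewrite -lnf; apply: (@mem_morphim _ _ _ (Morphism lM')); rewrite inE.
rewrite -[P in P \in _](normal_formP P Q R S) im.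
rewrite -[Q in Q \in _](normal_formQ P Q R S) im.
rewrite -[R in R \in _](normal_formR P Q R S) im.
by rewrite -[S in S \in _](normal_formS P Q R S) im.
Qed.

(* A model of XV: the multiplication of normal forms, with exponents read
   modulo p; for p odd, a(a-1)/2 stands for the binomial coefficient. *)
Section Model.
Variables (p : nat) (p_pr : prime p) (p_gt2 : (2 < p)%N).

Definition XV_model : predArgType := ('F_p * 'F_p * 'F_p * 'F_p)%type.

HB.instance Definition _ := Finite.on XV_model.

Local Open Scope ring_scope.

Let bin2 (a : 'F_p) : 'F_p := 2^-1 * a * (a - 1).

Let bin2D a b : bin2 (a + b) = bin2 a + bin2 b + a * b.
Proof.
have two_neq0 : (2 : 'F_p) != 0.
  by rewrite -[2]/(2%:R) -(dvdn_pcharf (pchar_Fp p_pr)) gtnNdvd.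
by rewrite /bin2; field.
Qed.

Let mul_model (x z : XV_model) : XV_model :=
  let: (a, b, c, d) := x in let: (a', b', c', d') := z in
  (a + a', b + b', c + c' + b * a', d + d' + c * a' + b * bin2 a').

Let inv_model (x : XV_model) : XV_model :=
  let: (a, b, c, d) := x in
  (- a, - b, b * a - c, b * bin2 a - (b * a - c) * a - d).

Let mul_modelA : associative mul_model.
Proof.
move=> [[[a b] c] d] [[[a' b'] c'] d'] [[[a2 b2] c2] d2] /=.
by rewrite bin2D; congr (_, _, _, _); ring.
Qed.

Let mul1_model : left_id (0, 0, 0, 0) mul_model.
Proof. by move=> [[[a b] c] d] /=; congr (_, _, _, _); ring. Qed.

Let mulV_model : left_inverse (0, 0, 0, 0) inv_model mul_model.
Proof. by move=> [[[a b] c] d] /=; congr (_, _, _, _); ring. Qed.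

HB.instance Definition _ :=
  Finite_isGroup.Build XV_model mul_modelA mul1_model mulV_model.

Let P : XV_model := (0, 0, 0, 1).
Let Q : XV_model := (0, 0, 1, 0).
Let R : XV_model := (0, 1, 0, 0).
Let S : XV_model := (1, 0, 0, 0).

Let bin20 : bin2 0 = 0. Proof. by rewrite /bin2; ring. Qed.
Let bin21 : bin2 1 = 0. Proof. by rewrite /bin2; ring. Qed.

Let mulE (a b c d a' b' c' d' : 'F_p) :
  ((a, b, c, d) : XV_model) ∘ ((a', b', c', d') : XV_model) =
  (a + a', b + b', c + c' + b * a', d + d' + c * a' + b * bin2 a').
Proof. by []. Qed.

Let PX n : (P ^+ n)%g = (0, 0, 0, n%:R).
Proof.
elim: n => // n IH; rewrite expgSr IH /P mulE bin20 -natr1.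
by congr (_, _, _, _); ring.
Qed.

Let QX n : (Q ^+ n)%g = (0, 0, n%:R, 0).
Proof.
elim: n => // n IH; rewrite expgSr IH /Q mulE bin20 -natr1.
by congr (_, _, _, _); ring.
Qed.

Let RX n : (R ^+ n)%g = (0, n%:R, 0, 0).
Proof.
elim: n => // n IH; rewrite expgSr IH /R mulE bin20 -natr1.
by congr (_, _, _, _); ring.
Qed.

Let SX n : (S ^+ n)%g = (n%:R, 0, 0, 0).
Proof.
elim: n => // n IH; rewrite expgSr IH /S mulE bin21 -natr1.
by congr (_, _, _, _); ring.
Qed.

Let model_relations : XV_relations p P Q R S.
Proof.
have p0 : p%:R = 0 :> 'F_p by apply: pchar_Fp_0.
split; rewrite ?PX ?QX ?RX ?SX ?p0 // /P /Q /R /S !mulE;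
  by rewrite ?bin20 ?bin21; congr (_, _, _, _); ring.
Qed.

Let model_card : #|XV_model| = (p ^ 4)%N.
Proof.
by rewrite !card_prod card_Fp // !expnS expn0 muln1 !mulnA.
Qed.

Let model_gen : <<[set P; Q; R; S]>>%g = [set: XV_model].
Proof.
apply/eqP; rewrite eqEsubset subsetT; apply/subsetP => -[[[a b] c] d] _.
have -> : (a, b, c, d) = (S ^+ a * R ^+ b * Q ^+ c * P ^+ d)%g :> XV_model.
  rewrite PX QX RX SX !natr_Zp !mulE bin20.
  by congr (_, _, _, _); ring.
by rewrite !groupM // groupX // mem_gen // !inE eqxx ?orbT.
Qed.

Lemma groupXV_exists : inhabited (groupXV p).
Proof. exact: (inhabits (GroupXV model_card model_gen model_relations)). Qed.

End Model.

(* Main.v *)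
Require Import Defs.
From mathcomp Require Import all_boot all_order all_algebra all_fingroup.
From mathcomp Require Import ring.

Set Implicit Arguments.
Unset Strict Implicit.
Unset Printing Implicit Defensive.

Import GRing.Theory.
Local Open Scope ring_scope.

(** Write x ∘ y = x + y + x ⋆ y, so that each x acts on the vector space A by
    the unipotent map 1 + (x ⋆ _), and let P generate the centre of the group.

    As (A, ∘) is a p-group, A has a full flag of left ideals (fixed_vector_mod,
    flag_exists). In coordinates c1, ..., c4 along it the operators x ⋆ _ are
    strictly triangular, and each defining relation of group XV becomes a system
    of polynomial equations between the coordinates of P, Q, R, S and the
    entries of their matrices. The matrix of P, a double commutator, has at most
    one nonzero entry, a41 P in the corner.

    If a41 P = 0, then P acts trivially, the flag can be chosen to end in P, and
    modulo the span of P and Q the operation ⋆ is commutative. The right series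
    then descends along the flag like the left one, and A is right nilpotent
    (right_nilpotent_socle).

    If a41 P is nonzero, the equality x ⋆ P = P ⋆ x ties the entry a43 x to the
    first coordinate of x. The equations show that c1 R is nonzero (c1R_neq0)
    and, after S has been multiplied by powers of R, Q, P so as to lie in the
    last term of the flag (flag_generator), that most entries vanish (rigidity);
    both use that 3 is invertible. Every product of two of the vectors
    P, Q, R, S is then forced up to the scalars i, k, y (table_exists), where
    y is nonzero because a41 P and c1 R are.

    Finally the maps v |-> g ∘ v for g = P, Q, R, S have, in the basis R, Q, P,
    S, exactly the matrices that define the brace A_{i,k,y}, and a brace is
    determined by these affine maps (brace_isomorphic_of_table). *)

(** * The operation ⋆ and the right series *)

Section LeftBrace.
Variable A : leftBraceType.
Implicit Types a b w x y z u v : A.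

Lemma brace_one : 1%g = 0 :> A.
Proof. by have := braceDr (1%g : A) 0 0; rewrite addr0 !mul1g add0r addr0. Qed.

Lemma brace_mulE x y : x ∘ y = x + y + x ⋆ y.
Proof. by rewrite /brace_star addrC [x + y]addrC addrA !subrK. Qed.

Lemma starDr x u v : x ⋆ (u + v) = x ⋆ u + x ⋆ v.
Proof.
have /(canRL (addrK _)) e := braceDr x u v.
by rewrite /brace_star e [RHS]addrACA [X in _ = X + _]addrACA opprD !addrA.
Qed.

Lemma star0r x : x ⋆ 0 = 0.
Proof. by apply: (addrI (x ⋆ 0)); rewrite -starDr !addr0. Qed.

Lemma starNr x u : x ⋆ (- u) = - (x ⋆ u).
Proof. by apply: (addrI (x ⋆ u)); rewrite -starDr !subrr star0r. Qed.

Lemma starBr x u v : x ⋆ (u - v) = x ⋆ u - x ⋆ v.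
Proof. by rewrite starDr starNr. Qed.

Lemma star0l x : 0 ⋆ x = 0.
Proof. by rewrite /brace_star -brace_one mul1g brace_one subr0 subrr. Qed.

Lemma starMl x y b : (x ∘ y) ⋆ b = x ⋆ b + y ⋆ b + x ⋆ (y ⋆ b).
Proof.
have : x ∘ (y ∘ b) = (x ∘ y) + b + (x ∘ y) ⋆ b.
  by rewrite mulgA; exact: brace_mulE.
set L := (x ∘ y) ⋆ b; rewrite !brace_mulE !starDr => e.
apply: (addrI (x + y + x ⋆ y + b)); rewrite -e.
by rewrite [LHS](AC (1*3*3) (1*2*5*3*(6*4*7))).
Qed.

(** The ⋆-commutator of two elements is their group commutator, up to the
    action of A on it. *)
Lemma star_commutator x z w : x ∘ z = z ∘ x ∘ w -> x ⋆ z = z ⋆ x + w + (z ∘ x) ⋆ w.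
Proof.
rewrite brace_mulE (brace_mulE (z ∘ x)) (brace_mulE z x) [z + x]addrC => /eqP.
by rewrite -!(addrA (x + z)) (inj_eq (addrI _)) => /eqP.
Qed.

Lemma star_commute x z : x ∘ z = z ∘ x -> x ⋆ z = z ⋆ x.
Proof.
move=> xz; have := @star_commutator x z 1%g; rewrite mulg1 => /(_ xz) ->.
by rewrite brace_one star0r !addr0.
Qed.

Definition absorbs (J : A -> Prop) := exists n, forall x, right_series n x -> J x.

(** This reduces right nilpotency to exhibiting a descending filtration by
    additive subsets. *)
Lemma absorbs_star (J' J : A -> Prop) : J 0 -> (forall u v, J u -> J v -> J (u + v)) ->
  (forall x y, J' x -> J (x ⋆ y)) -> absorbs J' -> absorbs J.
Proof.
move=> J0 JD JS [n nJ']; exists n.+1 => x [s [sJ' ->]].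
elim: s sJ' => [|ab s IH] sJ'; first by rewrite big_nil.
rewrite big_cons; apply: JD; last first.
  by apply: IH => cd cds; apply: sJ'; rewrite inE cds orbT.
by apply/JS/nJ'/sJ'; rewrite inE eqxx.
Qed.

End LeftBrace.

Section FpBrace.
Variables (p : nat) (A : fpBraceType p).
Implicit Types x y u v : A.

Lemma starZr x (c : 'F_p) u : x ⋆ (c *: u) = c *: (x ⋆ u).
Proof. exact: brace_starZr. Qed.

Lemma star_sumr I (r : seq I) (P : pred I) (F : I -> A) x :
  x ⋆ (\sum_(i <- r | P i) F i) = \sum_(i <- r | P i) x ⋆ F i.
Proof. by apply: (big_morph (brace_star x)); [exact: starDr | exact: star0r]. Qed.

End FpBrace.

(** * Unipotence of the operators x ⋆ _ *)

Section Unipotence.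
Variables (p : nat) (p_pr : prime p) (A : fpBraceType p).
Implicit Types x y u v e : A.

Lemma mulrn_dvd_Fp (V : lmodType 'F_p) (v : V) m : (p %| m)%N -> v *+ m = 0.
Proof.
rewrite (dvdn_pcharf (pchar_Fp p_pr)) -scaler_nat => /eqP ->.
by rewrite scale0r.
Qed.

Lemma starMnr x u n : x ⋆ (u *+ n) = (x ⋆ u) *+ n.
Proof. by elim: n => [|n IH]; rewrite ?star0r // !mulrS starDr IH. Qed.

(** Iterating the affine map v |-> u + v + x ⋆ v from 0 is Newton's formula
    ((1 + D)^n - 1) / D applied to u, where D = (x ⋆ _). *)
Lemma affine_iterE x u (f : nat -> A) : f 0%N = 0 ->
  (forall n, f n.+1 = u + f n + x ⋆ f n) ->
  forall n, f n = \sum_(i < n) iter i (brace_star x) u *+ 'C(n, i.+1).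
Proof.
move=> f0 fS; elim=> [|n IH]; first by rewrite f0 big_ord0.
under eq_bigr => i _ do rewrite binS mulrnDr.
rewrite big_split /= big_ord_recr /= bin_small // addr0 -IH.
rewrite big_ord_recl bin0 mulr1n fS [u + f n]addrC -addrA; congr (_ + (_ + _)).
rewrite [in LHS]IH star_sumr; apply: eq_bigr => i _.
by rewrite starMnr.
Qed.

(** In characteristic p only the last term of the formula survives at n = p. *)
Lemma affine_iter_p x u (f : nat -> A) : f 0%N = 0 ->
  (forall n, f n.+1 = u + f n + x ⋆ f n) -> f p = iter p.-1 (brace_star x) u.
Proof.
move=> f0 fS; have pE := prednK (prime_gt0 p_pr).
have := affine_iterE f0 fS p.-1.+1; rewrite {1}pE => ->.
rewrite big_ord_recr /= binn mulr1n big1 ?add0r // => i _.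
by apply: mulrn_dvd_Fp; rewrite pE prime_dvd_bin //= -[X in (_ < X)%N]pE ltnS.
Qed.

Lemma star_nilpotent x b : (x ^+ p)%g = 1%g -> iter p (brace_star x) b = 0.
Proof.
move=> xp; pose f n := (x ^+ n)%g ⋆ b.
have := @affine_iter_p x (x ⋆ b) f; rewrite /f xp expg0 brace_one !star0l.
have -> : iter p (brace_star x) b = iter p.-1 (brace_star x) (x ⋆ b).
  by rewrite -iterSr prednK // prime_gt0.
by move=> <- // n; rewrite expgS starMl.
Qed.

Lemma expg_star x : (x ^+ p)%g = iter p.-1 (brace_star x) x.
Proof.
apply: (@affine_iter_p x x (fun n => (x ^+ n)%g)) => [|n].
  by rewrite -brace_one.
by rewrite expgS brace_mulE.
Qed.

End Unipotence.

(** * Generators of group XV *)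

(** P, Q, R, S generate T as in group XV; finiteness makes every element a
    positive word, so normal forms replace generated subgroups. *)
Record XV_generators (p : nat) (T : monoidType) (P Q R S : T) : Prop := {
  gen_rel : XV_relations p P Q R S;
  gen_nf : forall x, exists a b c d, x = normal_form P Q R S a b c d
}.

Section Generators.
Variables (p : nat) (p_gt0 : (0 < p)%N) (T : groupType) (P Q R S : T).
Hypothesis gens : XV_generators p P Q R S.
Let rels := gen_rel gens.

Lemma gen_ind (H : T -> Prop) : H P -> H Q -> H R -> H S ->
  (forall x y, H x -> H y -> H (x ∘ y)) -> forall x, H x.
Proof.
move=> HP HQ HR HS HM.
have H1 : H 1%g.
  rewrite -(rel_Pp rels); case: (p) p_gt0 => // n _; elim: n => [|n IH].
    by rewrite expg1.
  by rewrite expgS; apply: HM.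
have HX x n : H x -> H (x ^+ n)%g.
  by move=> Hx; elim: n => [|n IH]; rewrite ?expg0 // expgS; apply: HM.
by move=> x; have [a [b [c [d ->]]]] := gen_nf gens x; do !apply: (HM) => //; apply: HX.
Qed.

Lemma gen_central x : P ∘ x = x ∘ P.
Proof.
case: rels => _ _ PS PQ PR _ _ _ _ _.
move: x; apply: gen_ind => // x y Px Py.
by rewrite mulgA Px -mulgA Py mulgA.
Qed.

(** The derived subgroup consists of the products Q^m P^n: reversing a
    product only changes the exponents of Q and P in the normal form. *)
Lemma gen_commutator x y : exists m n, x ∘ y = y ∘ x ∘ ((Q ^+ m) ∘ (P ^+ n))%g.
Proof.
have [a [b [c [d ->]]]] := gen_nf gens x.
have [a' [b' [c' [d' ->]]]] := gen_nf gens y.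
have tl m n : ((Q ^+ m) * (P ^+ n) = normal_form P Q R S 0 0 m n)%g.
  by rewrite /normal_form !expg0 !mul1g.
rewrite !(normal_formM rels) !(addnC a') !(addnC b').
set C1 := (c + _ + _)%N; set D1 := (d + _ + _ + _)%N.
set C2 := (c' + _ + _)%N; set D2 := (d' + _ + _ + _)%N.
exists (C1 + p.-1 * C2)%N, (D1 + p.-1 * D2)%N.
rewrite tl (normal_formM rels) !muln0 !addn0.
have wrap u v : (v + (u + p.-1 * v) = u %[mod p])%N.
  by rewrite addnCA -mulSn prednK // mulnC addnC modnMDl.
by rewrite -[RHS](normal_form_mod rels) !wrap (normal_form_mod rels).
Qed.

End Generators.


Lemma XV_generators_iso (p : nat) (G T : groupType) (phi : G -> T) (psi : T -> G)
  (P Q R S : T) : {morph phi : a b / a ∘ b} -> cancel phi psi -> cancel psi phi ->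
  XV_generators p P Q R S -> XV_generators p (psi P) (psi Q) (psi R) (psi S).
Proof.
move=> phiM phiK psiK [[QS QR PS PQ PR RS Pp Qp Rp Sp] nf].
have psiM x y : psi (x ∘ y) = psi x ∘ psi y.
  by apply: (can_inj phiK); rewrite phiM !psiK.
have psi1 : psi 1%g = 1%g.
  by apply: (mulgI (psi 1%g)); rewrite -psiM !mulg1.
have psiX x n : psi (x ^+ n)%g = (psi x ^+ n)%g.
  by elim: n => [|n IH]; rewrite ?expg0 // !expgS psiM IH.
split; first by split; rewrite -?psiX -?psiM ?QS ?QR ?PS ?PQ ?PR ?RS ?Pp ?Qp ?Rp ?Sp.
move=> x; have [a [b [c [d E]]]] := nf (phi x); exists a, b, c, d.
by rewrite -(phiK x) E /normal_form !psiM !psiX.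
Qed.

Lemma XV_P_neq1 (p : nat) (p_pr : prime p) (p_gt3 : (3 < p)%N) (G : groupXV p) :
  XV_P G != 1%g.
Proof.
apply/eqP => P1; have := XV_f1 p_pr p_gt3 G 0 0 0.
have [_ _ [lP _ _ _]] := lambdaP p_pr p_gt3 G 0 0 0.
rewrite /XV_f -P1 lP lin_of_imagesE => /colP/(_ 3%:R); rewrite !mxE /= => /eqP.
by rewrite !(mul1r, mul0r, mulr0, addr0, add0r, subr0) oner_eq0.
Qed.

(** * Full flags of left ideals *)

Section FixedVector.
Variables (p : nat) (p_pr : prime p) (A : fpBraceType p) (P Q R S : A).
Hypothesis gens : XV_generators p P Q R S.
Implicit Types x y u v e : A.
Let rels := gen_rel gens.

Variable U : pred A.
Hypotheses (U0 : U 0) (UD : forall u v, U u -> U v -> U (u + v)).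
Hypothesis (US : forall x u, U u -> U (x ⋆ u)).

Let last_escape x e : (x ^+ p)%g = 1%g -> ~~ U e ->
  exists n, ~~ U (iter n (brace_star x) e) /\ U (iter n.+1 (brace_star x) e).
Proof.
move=> xp eU; suff esc n : U (iter n (brace_star x) e) ->
    exists n, ~~ U (iter n (brace_star x) e) /\ U (iter n.+1 (brace_star x) e).
  by apply: (esc p); rewrite star_nilpotent.
elim: n => [|n IH]; first by rewrite /= (negPf eU).
by case: (boolP (U (iter n (brace_star x) e))) => [/IH // | nU Un]; exists n.
Qed.

(** Kolchin's argument along the series <P>, <P, Q>, <P, Q, R>, G: vectors
    fixed modulo U by one term of the series are stable under the next
    generator, whose unipotence yields vectors fixed by that one as well. *)
Lemma fixed_vector_mod e0 : ~~ U e0 -> exists e, ~~ U e /\ forall x, U (x ⋆ e).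
Proof.
have iterU (H : A -> Prop) x n e : (forall u, H u -> H (x ⋆ u)) -> H e ->
    H (iter n (brace_star x) e).
  by move=> HS He; elim: n => //= n; apply: HS.
(* The commutator w of y and z moves e only inside U, so the actions of y
   and z commute on e modulo U *)
have cwU y z w e : y ∘ z = z ∘ y ∘ w -> U (w ⋆ e) -> U (y ⋆ e) ->
    U (y ⋆ (z ⋆ e)).
  move=> yz we ye; have := starMl y z e.
  rewrite yz starMl [(z ∘ y) ⋆ e]starMl [z ⋆ e + _]addrC -!(addrA (y ⋆ e + z ⋆ e)).
  by move=> /addrI <-; apply: (UD (UD (US _ ye) we)); exact: US.
have cU y z e : y ∘ z = z ∘ y -> U (y ⋆ e) -> U (y ⋆ (z ⋆ e)).
  by move=> yz; apply: (cwU y z 1%g); rewrite ?mulg1 // brace_one star0l.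
case: rels => QS QR PS PQ PR RS Pp Qp Rp Sp eU.
have [n [e1U Pe1]] := last_escape Pp eU.
move: e1U Pe1; rewrite iterS; move: (iter n _ _) => e1 e1U Pe1.
have [n2 [e2U Qe2]] := last_escape Qp e1U.
have Pe2 : U (P ⋆ iter n2 (brace_star Q) e1).
  by apply: (iterU (fun e => U (P ⋆ e))) => // u; apply: cU.
move: e2U Qe2 Pe2; rewrite iterS; move: (iter n2 _ _) => e2 e2U Qe2 Pe2.
have [n3 [e3U Re3]] := last_escape Rp e2U.
have [Pe3 Qe3] : U (P ⋆ iter n3 (brace_star R) e2) /\ U (Q ⋆ iter n3 (brace_star R) e2).
  apply: (iterU (fun e => U (P ⋆ e) /\ U (Q ⋆ e))) => // u [Pu Qu].
  by split; apply: cU.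
move: e3U Re3 Pe3 Qe3; rewrite iterS; move: (iter n3 _ _) => e3 e3U Re3 Pe3 Qe3.
have [n4 [e4U Se4]] := last_escape Sp e3U.
have : [/\ U (P ⋆ iter n4 (brace_star S) e3), U (Q ⋆ iter n4 (brace_star S) e3)
  & U (R ⋆ iter n4 (brace_star S) e3)].
  apply: (iterU (fun e => [/\ U (P ⋆ e), U (Q ⋆ e) & U (R ⋆ e)])) => // u [Pu Qu Ru].
  by split; [apply: cU | apply: cwU QS _ _ | apply: cwU RS _ _].
move: e4U Se4; rewrite iterS; move: (iter n4 _ _) => e4 e4U Se4 [Pe4 Qe4 Re4].
exists e4; split=> //; apply: (gen_ind (prime_gt0 p_pr) gens) => // x y Ux Uy.
by rewrite starMl; apply: (UD (UD Ux Uy)); exact: US.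
Qed.

End FixedVector.

(** Coordinates along a full flag of left ideals
    A > <e2, e3, e4> > <e3, e4> > <e4> > 0: every operator (x ⋆ _) is strictly
    triangular in the basis e1, e2, e3, e4. *)
Record flag (p : nat) (A : fpBraceType p) := Flag {
  e1 : A; e2 : A; e3 : A; e4 : A;
  c1 : A -> 'F_p; c2 : A -> 'F_p; c3 : A -> 'F_p; c4 : A -> 'F_p;
  flagE : forall v, v = c1 v *: e1 + c2 v *: e2 + c3 v *: e3 + c4 v *: e4;
  flag_coord : forall a b c d (v := a *: e1 + b *: e2 + c *: e3 + d *: e4),
    [/\ c1 v = a, c2 v = b, c3 v = c & c4 v = d];
  flag_star1 : forall x, c1 (x ⋆ e1) = 0;
  flag_star2 : forall x, c1 (x ⋆ e2) = 0 /\ c2 (x ⋆ e2) = 0;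
  flag_star3 : forall x, [/\ c1 (x ⋆ e3) = 0, c2 (x ⋆ e3) = 0 & c3 (x ⋆ e3) = 0];
  flag_star4 : forall x, x ⋆ e4 = 0
}.

Section FlagExistence.
Variables (p : nat) (p_pr : prime p) (A : fpBraceType p).
Implicit Types (x y u v e : A) (es : seq A) (ts us : seq 'F_p).

Fixpoint lincomb es ts : A :=
  if (es, ts) is (e :: es', t :: ts') then t *: e + lincomb es' ts' else 0.

(** The span is a boolean predicate, so that membership can be decided. *)
Fixpoint spanned es : pred A :=
  if es is e :: es' then fun v => [exists c : 'F_p, spanned es' (v - c *: e)]
  else pred1 0.

(** A partial flag of left ideals, from its top vector to its bottom one. *)
Fixpoint adapted es : Prop :=
  if es is e :: es' then
    [/\ ~~ spanned es' e, forall x, spanned es' (x ⋆ e) & adapted es']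
  else True.

Let spanned_lincomb es v : spanned es v ->
  exists2 ts, size ts = size es & v = lincomb es ts.
Proof.
elim: es v => [|e es IH] v /= => [/eqP ->|/existsP[c /IH[ts sz E]]].
  by exists [::].
by exists (c :: ts); rewrite /= ?sz // -E addrC subrK.
Qed.

Let spanned0 es : spanned es 0.
Proof.
elim: es => //= e es IH; apply/existsP; exists 0.
by rewrite scale0r subr0.
Qed.

Let spannedD es u v : spanned es u -> spanned es v -> spanned es (u + v).
Proof.
elim: es u v => [|e es IH] u v /=; first by move=> /eqP-> /eqP->; rewrite addr0.
move=> /existsP[c uc] /existsP[d vd]; apply/existsP; exists (c + d).
by rewrite scalerDl opprD addrACA IH.
Qed.

Let spannedZ es k v : spanned es v -> spanned es (k *: v).
Proof.
elim: es v => [|e es IH] v /=; first by move=> /eqP->; rewrite scaler0.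
move=> /existsP[c vc]; apply/existsP; exists (k * c).
by rewrite -scalerA -scalerBr IH.
Qed.

Let lincomb_spanned es ts : spanned es (lincomb es ts).
Proof.
elim: es ts => [|e es IH] [|t ts] //=; first exact: (spanned0 (e :: es)).
by apply/existsP; exists t; rewrite addrC addrA addNr add0r.
Qed.

Let spannedS es x v : adapted es -> spanned es v -> spanned es (x ⋆ v).
Proof.
elim: es v => [|e es IH] v /=; first by move=> _ /eqP->; rewrite star0r.
case=> _ es_e ad /existsP[c /(IH _ ad) h]; apply/existsP; exists 0.
rewrite scale0r subr0; have := spannedD h (spannedZ c (es_e x)).
by rewrite starBr starZr subrK.
Qed.

Let lincombB es ts us : size ts = size es -> size us = size es ->
  lincomb es ts - lincomb es us = lincomb es [seq q.1 - q.2 | q <- zip ts us].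
Proof.
elim: es ts us => [|e es IH] [|t ts] [|u us] //=; rewrite ?subr0 //.
by move=> [st] [su]; rewrite opprD addrACA IH // scalerBl.
Qed.

Let lincomb_inj es ts us : adapted es -> size ts = size es ->
  size us = size es -> lincomb es ts = lincomb es us -> ts = us.
Proof.
elim: es ts us => [|e es IH] [|t ts] [|u us] //= [e_es _ ad] [st] [su] E.
have D : (t - u) *: e = lincomb es us - lincomb es ts.
  apply: (addIr (lincomb es ts)).
  by rewrite subrK scalerBl addrAC E addrC addKr.
have [tu|tu] := eqVneq t u; last first.
  case/negP: e_es; have -> : e = (t - u)^-1 *: ((t - u) *: e).
    by rewrite scalerA mulVf ?scale1r // subr_eq0.
  by rewrite D lincombB // spannedZ.
by move: E; rewrite tu => /addrI /(IH _ _ ad st su) ->.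
Qed.

Let lincomb_tail es1 es2 ts v : adapted (es1 ++ es2) ->
  size ts = size (es1 ++ es2) -> v = lincomb (es1 ++ es2) ts -> spanned es2 v ->
  take (size es1) ts = nseq (size es1) 0.
Proof.
move=> ad sz -> /spanned_lincomb[us su E].
have nseq0 : lincomb es2 us = lincomb (es1 ++ es2) (nseq (size es1) 0 ++ us).
  by elim: es1 {ad sz E} => //= e es1 IH; rewrite scale0r add0r.
rewrite nseq0 in E; rewrite (lincomb_inj ad sz _ E) ?take_size_cat ?size_nseq //.
by rewrite !size_cat size_nseq su.
Qed.

Variables (T : finType) (phi : A -> T) (phi_bij : bijective phi).
Hypothesis cardT : #|T| = (p ^ 4)%N.

(* A spanning list has at least, an independent one at most, 4 vectors, by
   counting linear combinations against the order p ^ 4. *)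
Let spanned_size es : (forall v, spanned es v) -> (4 <= size es)%N.
Proof.
move=> full; have p_gt1 := prime_gt1 p_pr.
rewrite -(leq_exp2l _ _ p_gt1) -cardT.
have -> : (p ^ size es)%N = #|{:(size es).-tuple 'F_p}| by rewrite card_tuple card_Fp.
pose f (t : (size es).-tuple 'F_p) := phi (lincomb es t).
apply: leq_trans (leq_image_card f _); apply/subset_leq_card/subsetP => g _.
have [psi _ psiK] := phi_bij.
have [ts sz E] := spanned_lincomb (full (psi g)).
apply/codomP; exists (tcast sz (in_tuple ts)).
by rewrite /f val_tcast /= -E psiK.
Qed.

Let adapted_size es : adapted es -> (size es <= 4)%N.
Proof.
move=> ad; have p_gt1 := prime_gt1 p_pr.
rewrite -(leq_exp2l _ _ p_gt1) -cardT.
have -> : (p ^ size es)%N = #|{:(size es).-tuple 'F_p}| by rewrite card_tuple card_Fp.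
pose f (t : (size es).-tuple 'F_p) := phi (lincomb es t).
apply: (@leq_card _ _ f) => t u /(bij_inj phi_bij).
by move=> /(lincomb_inj ad (size_tuple t) (size_tuple u)) /val_inj.
Qed.

Variables (P Q R S : A).
Hypothesis gens : XV_generators p P Q R S.

Let adapted_full es : adapted es -> exists es',
  adapted (es' ++ es) /\ forall v, spanned (es' ++ es) v.
Proof.
have [n] := ubnP (4 - size es); elim: n es => // n IH es ub ad.
have [full|nfull] : (forall v, spanned es v) \/ exists v, ~~ spanned es v.
  have [psi phiK psiK] := phi_bij.
  have [/forallP full|/forallPn[g ng]] := boolP [forall g, spanned es (psi g)].
    by left=> v; rewrite -(phiK v).
  by right; exists (psi g).
  by exists [::].
have [e0 e0es] := nfull.
have [e [ees se]] := @fixed_vector_mod _ p_pr _ _ _ _ _ gens (spanned es)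
  (spanned0 es) (@spannedD es) (fun x u => @spannedS es x u ad) e0 e0es.
have ad' : adapted (e :: es) by [].
have [|es' [ad2 full]] := IH (e :: es) _ ad'.
  by have /= := adapted_size ad'; case: (size es) ub => [|[|[|[|]]]].
by exists (rcons es' e); rewrite cat_rcons.
Qed.

(** The last vector of the flag may be any nonzero vector fixed by A. *)
Lemma flag_exists z : z != 0 -> (forall x, x ⋆ z = 0) ->
  exists F : flag A, e4 F = z.
Proof.
move=> z0 Az; have adz : adapted [:: z] by split=> //= x; rewrite Az.
have [es [ad full]] := adapted_full adz.
have sz : size (es ++ [:: z]) = 4.
  by apply/eqP; rewrite eqn_leq adapted_size // spanned_size.
move: sz; rewrite size_cat addn1 => -[].
case: es ad full => [|f1 [|f2 [|f3 []]]] // ad full _.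
have inj4 a b c d a' b' c' d' :
    lincomb [:: f1; f2; f3; z] [:: a; b; c; d] =
    lincomb [:: f1; f2; f3; z] [:: a'; b'; c'; d'] ->
    [:: a; b; c; d] = [:: a'; b'; c'; d'] by exact: lincomb_inj.
pose comb (t : 'F_p * 'F_p * 'F_p * 'F_p) : A :=
  t.1.1.1 *: f1 + t.1.1.2 *: f2 + t.1.2 *: f3 + t.2 *: z.
have combE a b c d : comb (a, b, c, d) = lincomb [:: f1; f2; f3; z] [:: a; b; c; d].
  by rewrite /= addr0 !addrA.
have ex v : exists t, v == comb t.
  have [[|a [|b [|c [|d [|? ?]]]]] // _ ->] := spanned_lincomb (full v).
  by exists (a, b, c, d); rewrite combE.
pose co v := xchoose (ex v).
have coK v : v = comb (co v) by apply/eqP/(xchooseP (ex v)).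
have combK t : co (comb t) = t.
  have := coK (comb t); case: (co _) => [[[a b] c] d]; case: t => [[[a' b'] c'] d'].
  by rewrite !combE => /inj4[-> -> -> ->].
have tail_coords es1 es2 v : es1 ++ es2 = [:: f1; f2; f3; z] -> spanned es2 v ->
    take (size es1) [:: (co v).1.1.1; (co v).1.1.2; (co v).1.2; (co v).2] =
    nseq (size es1) 0.
  move=> Ees vs; apply: lincomb_tail vs; rewrite Ees //.
  by rewrite {1}(coK v) -combE -!surjective_pairing.
case: (ad) => /= _ s1 [_ s2 [_ s3 _]].
unshelve eexists (@Flag p A f1 f2 f3 z (fun v => (co v).1.1.1)
  (fun v => (co v).1.1.2) (fun v => (co v).1.2) (fun v => (co v).2) _ _ _ _ _ _).
- by move=> v; apply: coK.
- by move=> a b c d /=; have /= -> := combK (a, b, c, d).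
- by move=> x; have [] := tail_coords [:: f1] [:: f2; f3; z] (x ⋆ f1) erefl (s1 x).
- by move=> x; have [] := tail_coords [:: f1; f2] [:: f3; z] (x ⋆ f2) erefl (s2 x).
- by move=> x; have [] := tail_coords [:: f1; f2; f3] [:: z] (x ⋆ f3) erefl (s3 x).
- exact: Az.
by [].
Qed.

Lemma flag_inhabited : inhabited (flag A).
Proof.
have [e0 e00] : exists e0 : A, e0 != 0.
  have [psi phiK psiK] := phi_bij.
  have : (1 < #|T|)%N.
    by rewrite cardT; apply: leq_ltn_trans (ltn_expl _ (prime_gt1 p_pr)).
  case/card_gt1P=> g [h [_ _ gh]].
  have [pg|] := eqVneq (psi g) 0; last by exists (psi g).
  exists (psi h); apply: contraNneq gh => ph.
  by rewrite -(psiK g) -(psiK h) pg ph.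
have [||e [e_n0 Ae]] := @fixed_vector_mod _ p_pr _ _ _ _ _ gens (pred1 0)
  (eqxx _) _ _ e0 e00.
- by move=> u v /= /eqP-> /eqP->; rewrite addr0.
- by move=> x u /= /eqP->; rewrite star0r.
by have [F _] := flag_exists e_n0 (fun x => eqP (Ae x)); split.
Qed.

End FlagExistence.

(** * Triangular coordinates *)

Section FlagTheory.
Variables (p : nat) (A : fpBraceType p) (F : flag A).
Implicit Types x y u v b : A.
Local Notation c1 := (c1 F). Local Notation c2 := (c2 F).
Local Notation c3 := (c3 F). Local Notation c4 := (c4 F).
Local Notation e1 := (e1 F). Local Notation e2 := (e2 F).
Local Notation e3 := (e3 F). Local Notation e4 := (e4 F).

Lemma flag_ext u v : c1 u = c1 v -> c2 u = c2 v -> c3 u = c3 v -> c4 u = c4 v ->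
  u = v.
Proof. by move=> E1 E2 E3 E4; rewrite (flagE F u) E1 E2 E3 E4 -flagE. Qed.

Lemma flagD u v : (c1 (u + v) = c1 u + c1 v) * (c2 (u + v) = c2 u + c2 v)
  * (c3 (u + v) = c3 u + c3 v) * (c4 (u + v) = c4 u + c4 v).
Proof.
have : u + v = (c1 u + c1 v) *: e1 + (c2 u + c2 v) *: e2
             + (c3 u + c3 v) *: e3 + (c4 u + c4 v) *: e4.
  rewrite {1}(flagE F u) {1}(flagE F v) !scalerDl.
  by rewrite [LHS](AC (4*4) (1*5*(2*6)*(3*7)*(4*8))).
have [] := flag_coord F (c1 u + c1 v) (c2 u + c2 v) (c3 u + c3 v) (c4 u + c4 v).
by move=> E1 E2 E3 E4 E; rewrite -E in E1 E2 E3 E4; rewrite E1 E2 E3 E4.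
Qed.

Lemma flagZ k u : (c1 (k *: u) = k * c1 u) * (c2 (k *: u) = k * c2 u)
  * (c3 (k *: u) = k * c3 u) * (c4 (k *: u) = k * c4 u).
Proof.
have : k *: u = (k * c1 u) *: e1 + (k * c2 u) *: e2
              + (k * c3 u) *: e3 + (k * c4 u) *: e4.
  by rewrite {1}(flagE F u) !scalerDr !scalerA.
have [] := flag_coord F (k * c1 u) (k * c2 u) (k * c3 u) (k * c4 u).
by move=> E1 E2 E3 E4 E; rewrite -E in E1 E2 E3 E4; rewrite E1 E2 E3 E4.
Qed.

Lemma flag0 : (c1 0 = 0) * (c2 0 = 0) * (c3 0 = 0) * (c4 0 = 0).
Proof. by rewrite -(scale0r (0 : A)) !flagZ !mul0r. Qed.

Lemma flagN u : (c1 (- u) = - c1 u) * (c2 (- u) = - c2 u)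
  * (c3 (- u) = - c3 u) * (c4 (- u) = - c4 u).
Proof. by rewrite -scaleN1r !flagZ !mulN1r. Qed.

(** aij x is the entry in row i and column j of the matrix of (x ⋆ _). *)
Definition a21 x := c2 (x ⋆ e1).
Definition a31 x := c3 (x ⋆ e1).
Definition a41 x := c4 (x ⋆ e1).
Definition a32 x := c3 (x ⋆ e2).
Definition a42 x := c4 (x ⋆ e2).
Definition a43 x := c4 (x ⋆ e3).

Let starE x b : x ⋆ b = c1 b *: (x ⋆ e1) + c2 b *: (x ⋆ e2) + c3 b *: (x ⋆ e3).
Proof. by rewrite {1}(flagE F b) !starDr !starZr flag_star4 scaler0 addr0. Qed.

Lemma flag_star x b : (c1 (x ⋆ b) = 0) * (c2 (x ⋆ b) = a21 x * c1 b)
  * (c3 (x ⋆ b) = a31 x * c1 b + a32 x * c2 b)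
  * (c4 (x ⋆ b) = a41 x * c1 b + a42 x * c2 b + a43 x * c3 b).
Proof.
rewrite [x ⋆ b]starE !flagD !flagZ flag_star1.
have [-> ->] := flag_star2 F x; have [-> -> ->] := flag_star3 F x.
by rewrite !(mulr0, addr0) !(mulrC (c1 b), mulrC (c2 b), mulrC (c3 b)).
Qed.

Lemma flagM x y : (c1 (x ∘ y) = c1 x + c1 y)
  * (c2 (x ∘ y) = c2 x + c2 y + a21 x * c1 y)
  * (c3 (x ∘ y) = c3 x + c3 y + (a31 x * c1 y + a32 x * c2 y))
  * (c4 (x ∘ y) = c4 x + c4 y + (a41 x * c1 y + a42 x * c2 y + a43 x * c3 y)).
Proof. by rewrite brace_mulE !(flagD (x + y)) !(flagD x y) !flag_star addr0. Qed.

Let coord_e1 : (c1 e1 = 1) * (c2 e1 = 0) * (c3 e1 = 0).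
Proof.
have [] := flag_coord F 1 0 0 0.
by rewrite scale1r !scale0r !addr0 => -> -> ->.
Qed.

Lemma c1_e1 : c1 e1 = 1. Proof. by rewrite coord_e1. Qed.

Let coord_e2 : (c1 e2 = 0) * (c2 e2 = 1) * (c3 e2 = 0).
Proof.
have [] := flag_coord F 0 1 0 0.
by rewrite scale1r !scale0r !addr0 add0r => -> -> ->.
Qed.

Let coord_e3 : (c1 e3 = 0) * (c2 e3 = 0) * (c3 e3 = 1).
Proof.
have [] := flag_coord F 0 0 1 0.
by rewrite scale1r !scale0r !addr0 !add0r => -> -> ->.
Qed.

Lemma flag_e4 : (c1 e4 = 0) * (c2 e4 = 0) * (c3 e4 = 0) * (c4 e4 = 1).
Proof.
have [] := flag_coord F 0 0 0 1.
by rewrite scale1r !scale0r !add0r => -> -> -> ->.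
Qed.

Lemma flag_entryM x y : (a21 (x ∘ y) = a21 x + a21 y)
  * (a31 (x ∘ y) = a31 x + a31 y + a32 x * a21 y)
  * (a41 (x ∘ y) = a41 x + a41 y + (a42 x * a21 y + a43 x * a31 y))
  * (a32 (x ∘ y) = a32 x + a32 y)
  * (a42 (x ∘ y) = a42 x + a42 y + a43 x * a32 y)
  * (a43 (x ∘ y) = a43 x + a43 y).
Proof.
have sM b := starMl x y b.
rewrite /a21 /a31 /a41 /a32 /a42 /a43 !sM.
rewrite !(flagD (_ ⋆ _ + _ ⋆ _)) !(flagD (_ ⋆ _) (_ ⋆ _)) !flag_star.
rewrite !coord_e1 !coord_e2 !coord_e3 /a21 /a31 /a41 /a32 /a42 /a43.
by rewrite !(mulr0, mulr1, addr0, add0r).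
Qed.

Lemma star_nil4 x u b c d : x ⋆ (u ⋆ (b ⋆ (c ⋆ d))) = 0.
Proof.
by apply: flag_ext; rewrite !flag_star !flag0 ?mulr0 ?addr0 ?mulr0 ?addr0 ?mulr0.
Qed.

End FlagTheory.

(** For p > 4 the group (A, ∘) has exponent p, since a full flag has length 4. *)
Lemma flag_exponent (p : nat) (p_pr : prime p) (A : fpBraceType p) (F : flag A)
  (x : A) : (3 < p)%N -> (x ^+ p)%g = 1%g.
Proof.
move=> p_gt3; have p_gt4 : (4 < p)%N.
  by rewrite ltn_neqAle p_gt3 andbT; apply: contraTneq p_pr => <-.
rewrite expg_star // brace_one; have -> : p.-1 = (4 + p.-1.-2.-2)%N.
  by case: (p) p_gt4 => [|[|[|[|[|]]]]].
by rewrite iterD /= (star_nil4 F).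
Qed.

(** * The relations of group XV in triangular coordinates *)

Section LinearCombination.
Variable K : comNzRingType.
Implicit Types L M X Y k : K.

Lemma lincomb_eq k L M X Y : L = M -> X - Y = k * (L - M) -> X = Y.
Proof. by move=> -> /eqP; rewrite subrr mulr0 subr_eq0 => /eqP. Qed.

Lemma lincomb_eq2 k1 k2 L1 M1 L2 M2 X Y : L1 = M1 -> L2 = M2 ->
  X - Y = k1 * (L1 - M1) + k2 * (L2 - M2) -> X = Y.
Proof.
move=> -> ->; rewrite !subrr !mulr0 addr0 => /eqP.
by rewrite subr_eq0 => /eqP.
Qed.

End LinearCombination.

Arguments lincomb_eq {K} k {L M X Y}.
Arguments lincomb_eq2 {K} k1 k2 {L1 M1 L2 M2 X Y}.

Section FlagRelations.
Variables (p : nat) (A : fpBraceType p) (F : flag A) (P Q R S : A).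
Hypothesis rels : XV_relations p P Q R S.
Local Notation c1 := (c1 F). Local Notation c2 := (c2 F).
Local Notation c3 := (c3 F). Local Notation c4 := (c4 F).
Local Notation a21 := (a21 F). Local Notation a31 := (a31 F).
Local Notation a41 := (a41 F). Local Notation a32 := (a32 F).
Local Notation a42 := (a42 F). Local Notation a43 := (a43 F).

Let ofRS (f : A -> 'F_p) := congr1 f (rel_RS rels).
Let ofQS (f : A -> 'F_p) := congr1 f (rel_QS rels).
Let ofQR (f : A -> 'F_p) := congr1 f (rel_QR rels).
Let E := (flag_entryM F, flagM F).

Lemma entriesQ : (a21 Q = 0) * (a32 Q = 0) * (a43 Q = 0) * (c1 Q = 0).
Proof.
do ![split]; [have := ofRS a21 | have := ofRS a32 | have := ofRS a43
  | have := ofRS c1]; rewrite !E => H; by apply: (lincomb_eq (-1) H); ring.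
Qed.

Lemma entriesP : (a21 P = 0) * (a32 P = 0) * (a43 P = 0) * (a31 P = 0)
  * (a42 P = 0) * (c1 P = 0) * (c2 P = 0).
Proof.
have P1 : (a21 P = 0) * (a32 P = 0) * (a43 P = 0) * (c1 P = 0).
  do ![split]; [have := ofQS a21 | have := ofQS a32 | have := ofQS a43
    | have := ofQS c1]; rewrite !E => H; by apply: (lincomb_eq (-1) H); ring.
do ![split]; rewrite ?P1 //; [have := ofQS a31 | have := ofQS a42
  | have := ofQS c2]; rewrite !E !P1 !entriesQ => H;
  by apply: (lincomb_eq (-1) H); ring.
Qed.

Lemma a31Q : a31 Q = a32 R * a21 S - a32 S * a21 R.
Proof.
have := ofRS a31; rewrite !E !entriesQ => H.
by apply: (lincomb_eq (-1) H); ring.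
Qed.

Lemma a42Q : a42 Q = a43 R * a32 S - a43 S * a32 R.
Proof.
have := ofRS a42; rewrite !E !entriesQ => H.
by apply: (lincomb_eq (-1) H); ring.
Qed.

Lemma a41P : a41 P = a42 Q * a21 S - a43 S * a31 Q.
Proof.
have := ofQS a41; rewrite !E !entriesQ !entriesP => H.
by apply: (lincomb_eq (-1) H); ring.
Qed.

Lemma a41_QR : a42 Q * a21 R = a43 R * a31 Q.
Proof.
have := ofQR a41; rewrite !E !entriesQ => H.
by apply: (lincomb_eq 1 H); ring.
Qed.

Lemma c3_QR : a31 Q * c1 R = a32 R * c2 Q.
Proof.
have := ofQR c3; rewrite !E !entriesQ => H.
by apply: (lincomb_eq 1 H); ring.
Qed.

Lemma c3_QS : a31 Q * c1 S = a32 S * c2 Q + c3 P.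
Proof.
have := ofQS c3; rewrite !E !entriesQ !entriesP => H.
by apply: (lincomb_eq 1 H); ring.
Qed.

Lemma c2_RS : a21 R * c1 S = a21 S * c1 R + c2 Q.
Proof.
have := ofRS c2; rewrite !E !entriesQ => H.
by apply: (lincomb_eq 1 H); ring.
Qed.

Lemma c4_central b : P ∘ b = b ∘ P -> a41 P * c1 b = a43 b * c3 P.
Proof.
move/(congr1 c4); rewrite !E !entriesP => H.
by apply: (lincomb_eq 1 H); ring.
Qed.

End FlagRelations.

(** * Trivial action of the centre forces right nilpotency *)

Section CentralSocle.
Variables (p : nat) (p_pr : prime p) (p_gt2 : (2 < p)%N) (A : fpBraceType p).
Variables (P Q R S : A) (F : flag A).
Hypotheses (gens : XV_generators p P Q R S) (eP : e4 F = P).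
Hypothesis starP : forall b, P ⋆ b = 0.
Local Notation c1 := (c1 F). Local Notation c2 := (c2 F).
Local Notation c3 := (c3 F). Local Notation c4 := (c4 F).
Let rels := gen_rel gens.
Let p_gt0 := prime_gt0 p_pr.
Implicit Types x y b u v : A.

Let two_neq0 : 2%:R != 0 :> 'F_p.
Proof. by rewrite -(dvdn_pcharf (pchar_Fp p_pr)) gtnNdvd. Qed.

Let coordP : (c1 P = 0) * (c2 P = 0) * (c3 P = 0) * (c4 P = 1).
Proof. by rewrite -eP !flag_e4. Qed.

Let star_P x : x ⋆ P = 0. Proof. by rewrite -eP flag_star4. Qed.

(** Q is central modulo P, so Q ⋆ x and x ⋆ Q agree modulo P for x = R, S.
    Substituting this into the entry of the commutator relation between R and S
    gives 2 * a31 Q * c2 Q = 0. *)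
Let a31Q0 : a31 F Q = 0.
Proof.
have QR := c3_QR F rels; have := c3_QS F rels; have RS := c2_RS F rels.
rewrite coordP addr0 => QS; apply/eqP/contraT => a31n0.
have Q2 : c2 Q = 0.
  have : a31 F Q * (a21 F R * c1 S - a21 F S * c1 R)
      + (a32 F R * a21 F S - a32 F S * a21 F R) * c2 Q = 0.
    by apply: (lincomb_eq2 (a21 F R) (- a21 F S) QS QR); ring.
  rewrite -(a31Q F rels) RS [_ + c2 Q]addrC addrK -mulr2n -mulr_natl.
  by move=> /eqP; rewrite !mulf_eq0 (negPf two_neq0) (negPf a31n0) => /eqP.
have R0 : c1 R = 0.
  by move: QR; rewrite Q2 mulr0 => /eqP; rewrite mulf_eq0 (negPf a31n0) => /eqP.
have S0 : c1 S = 0.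
  by move: QS; rewrite Q2 mulr0 => /eqP; rewrite mulf_eq0 (negPf a31n0) => /eqP.
have : c1 (e1 F) = 0.
  apply: (@gen_ind _ p_gt0 _ _ _ _ _ gens (fun x => c1 x = 0));
    rewrite ?coordP ?(entriesQ F rels) //.
  by move=> x y x0 y0; rewrite flagM x0 y0 addr0.
by rewrite c1_e1 => /eqP; rewrite oner_eq0.
Qed.

Let a32Q2 x : a32 F x * c2 Q = 0.
Proof.
move: x; apply: (gen_ind p_gt0 gens).
- by rewrite (entriesP F rels) mul0r.
- by rewrite (entriesQ F rels) mul0r.
- by rewrite -(c3_QR F rels) a31Q0 mul0r.
- by have := c3_QS F rels; rewrite a31Q0 mul0r coordP addr0.
by move=> x y x0 y0; rewrite flag_entryM mulrDl x0 y0 addr0.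
Qed.

Let W k v : Prop := match k with
  | 0 => True
  | 1 => c1 v = 0
  | 2 => c1 v = 0 /\ c2 v = 0
  | _ => [/\ c1 v = 0, c2 v = 0 & c3 v = 0]
  end.

Let WD k u v : W k u -> W k v -> W k (u + v).
Proof.
case: k => [|[|[|k]]] //=; rewrite ?flagD; first by move=> -> ->; rewrite addr0.
  by move=> [-> ->] [-> ->]; rewrite addr0.
by move=> [-> -> ->] [-> -> ->]; rewrite addr0.
Qed.

Let WZ k c v : W k v -> W k (c *: v).
Proof.
by case: k => [|[|[|k]]] //=; rewrite !flagZ; [move=> ->|move=> [-> ->]
  |move=> [-> -> ->]]; rewrite mulr0.
Qed.

Let W_star k x v : W k v -> W k.+1 (x ⋆ v).
Proof.
case: k => [|[|[|k]]] /=; rewrite !flag_star //.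
- by move=> ->; rewrite mulr0.
- by move=> [-> ->]; rewrite !mulr0 addr0.
by move=> [-> -> _]; rewrite !mulr0 addr0.
Qed.

Let W3E v : W 3 v -> v = c4 v *: P.
Proof.
move=> [v1 v2 v3]; apply: (flag_ext (F := F)); rewrite flagZ coordP ?mulr0 //.
by rewrite mulr1.
Qed.

Let WP k : W k P. Proof. by case: k => [|[|[|k]]] //=; rewrite !coordP. Qed.

Let W0 k : W k 0. Proof. by rewrite -(scale0r P); apply/WZ/WP. Qed.

Let W3W k v : W 3 v -> W k v.
Proof. by case: k => [|[|[|k]]] //= []. Qed.

Let starQl b : W 3 (Q ⋆ b).
Proof. by split; rewrite flag_star // ?a31Q0 !(entriesQ F rels) !mul0r ?addr0. Qed.

Let starQr x : W 3 (x ⋆ Q).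
Proof.
by split; rewrite flag_star // !(entriesQ F rels) mulr0 // a32Q2 addr0.
Qed.

Let J k v := exists t, W k (v - t *: Q).

Let JD k u v : J k u -> J k v -> J k (u + v).
Proof.
move=> [t ut] [s vs]; exists (t + s).
by rewrite scalerDl opprD addrACA; apply: WD.
Qed.

Let WJ k v : W k v -> J k v.
Proof. by move=> Wv; exists 0; rewrite scale0r subr0. Qed.

Let J_star k x v : J k v -> W k.+1 (x ⋆ v).
Proof.
move=> [t vt].
have -> : x ⋆ v = x ⋆ (v - t *: Q) + t *: (x ⋆ Q) by rewrite starBr starZr subrK.
by apply: WD; [apply: W_star | apply/WZ/W3W/starQr].
Qed.

Let derJ m n : J 3 ((Q ^+ m) ∘ (P ^+ n))%g.
Proof.
elim: m => [|m IH].
  rewrite expg0 mul1g; apply: WJ; elim: n => [|n IH].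
    by rewrite expg0 brace_one; apply: W0.
  by rewrite expgS brace_mulE starP addr0; apply: WD => //; apply: WP.
rewrite expgS -mulgA brace_mulE; apply: JD; last exact/WJ/starQl.
apply: JD => //; exists 1; rewrite scale1r subrr; exact: W0.
Qed.

(** Modulo the left ideal J 3 = <Q, P> the operation ⋆ is commutative, so the
    left series, which descends along the flag, also bounds the right one. *)
Let J_starl k x y : J k x -> J k.+1 (x ⋆ y).
Proof.
move=> Jx; have [m [n]] := gen_commutator p_gt0 gens x y.
move: (derJ m n); move: (_ ∘ _) => d Jd /star_commutator ->.
have J3J v : J 3 v -> J k.+1 v by move=> [t vt]; exists t; apply: W3W.
apply: JD; first by apply: JD; [apply/WJ/J_star | apply: J3J].
by apply/J3J/WJ/(J_star _ Jd).
Qed.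

Let W3_starl x b : W 3 x -> x ⋆ b = 0.
Proof.
move=> /W3E ->; rewrite -[c4 x]natr_Zp scaler_nat.
elim: (val (c4 x)) => [|n IH]; first by rewrite star0l.
have -> : P *+ n.+1 = P ∘ (P *+ n) by rewrite brace_mulE starP addr0 mulrS.
by rewrite starMl starP IH star0r !addr0.
Qed.

Let J3_starl x b : J 3 x -> W 3 (x ⋆ b).
Proof.
move=> [t /W3E]; move: (c4 _) => s /eqP; rewrite subr_eq addrC => /eqP ->.
rewrite -[t]natr_Zp scaler_nat; elim: (val t) s => [|n IH] s.
  by rewrite add0r W3_starl; [apply: W0 | apply/WZ/WP].
have /W3E := starQl (Q *+ n + s *: P); move: (c4 _) => k E.
have -> : Q *+ n.+1 + s *: P = Q ∘ (Q *+ n + (s - k) *: P).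
  rewrite scalerBl addrA brace_mulE starBr starZr star_P scaler0 subr0 E.
  by rewrite -[RHS]addrA subrK mulrS addrA.
rewrite starMl; apply: WD; last by apply: (@W_star 3 _ _ (IH _)).
by apply: WD => //; exact: starQl.
Qed.

(** The right series passes through J 0, J 1, J 2, J 3, W 3 and 0: down to J 3
    this happens modulo <P, Q>, and the last two steps take place inside it. *)
Lemma right_nilpotent_socle : right_nilpotent A.
Proof.
have J0 k : J k 0 by exact/WJ/W0.
have absJ k : absorbs (J k).
  elim: k => [|k IH]; first by exists 0%N => x _; apply: WJ.
  exact: (absorbs_star (J0 _) (@JD _) (@J_starl k) IH).
have absW : absorbs (W 3) by exact: (absorbs_star (W0 3) (@WD 3) J3_starl (absJ 3)).
have := @absorbs_star A (W 3) (fun x => x = 0) erefl; apply => //.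
by move=> u v -> ->; rewrite addr0.
Qed.

End CentralSocle.

(** * Nontrivial action of the centre *)

Lemma XV_relations_mulS (p : nat) (T : groupType) (P Q R S x : T) :
  XV_relations p P Q R S -> P ∘ x = x ∘ P -> Q ∘ x = x ∘ Q -> R ∘ x = x ∘ R ->
  ((S ∘ x) ^+ p)%g = 1%g -> XV_relations p P Q R (S ∘ x).
Proof.
case=> QS QR PS PQ PR RS Pp Qp Rp Sp Px Qx Rx Sxp; split=> //.
- by rewrite !mulgA QS -!mulgA; congr (_ ∘ _); rewrite Px !mulgA Qx.
- by rewrite !mulgA PS -!mulgA Px.
by rewrite !mulgA RS -!mulgA; congr (_ ∘ _); rewrite Qx !mulgA Rx.
Qed.

Section FaithfulCenter.
Variables (p : nat) (p_pr : prime p) (p_gt3 : (3 < p)%N) (A : fpBraceType p).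
Variables (F : flag A) (P Q R : A).
Hypotheses (Pc : forall x, P ∘ x = x ∘ P) (a41n0 : a41 F P != 0).
Local Notation c1 := (c1 F). Local Notation c2 := (c2 F).
Local Notation c3 := (c3 F). Local Notation c4 := (c4 F).
Local Notation a21 := (a21 F). Local Notation a31 := (a31 F).
Local Notation a41 := (a41 F). Local Notation a32 := (a32 F).
Local Notation a42 := (a42 F). Local Notation a43 := (a43 F).

Let three_neq0 : 3%:R != 0 :> 'F_p.
Proof. by rewrite -(dvdn_pcharf (pchar_Fp p_pr)) gtnNdvd. Qed.

Section CenterEntries.
Variable S : A.
Hypothesis rels : XV_relations p P Q R S.
Let a43E b : a43 b * c3 P = a41 P * c1 b.
Proof. by rewrite (c4_central F rels). Qed.

Lemma c3P_neq0 : c3 P != 0.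
Proof.
apply: contraNneq a41n0 => P3; have := a43E (e1 F).
by rewrite P3 mulr0 c1_e1 mulr1 => <-.
Qed.
Let P3n0 := c3P_neq0.

(** The coordinate c1 is a homomorphism whose kernel is a maximal subgroup.
    Were it the abelian one, <P, Q, R>, the entries of the relations would give
    two values for c3 P whose difference is 3 * c1 S * a31 Q; so a31 Q = 0, and
    then c3 P = 0. *)
Lemma c1R_neq0 : c1 R != 0.
Proof.
apply/eqP => R1.
have r43 : a43 R = 0.
  by apply/eqP; have /eqP := a43E R; rewrite R1 mulr0 mulf_eq0 (negPf P3n0) orbF.
have Q2 : c2 Q = a21 R * c1 S by rewrite (c2_RS F rels) R1; ring.
have P3 : c3 P = c1 S * (a32 R * a21 S - 2%:R * a32 S * a21 R).
  have := c3_QS F rels; rewrite Q2 (a31Q F rels) => H.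
  by apply: (lincomb_eq (-1) H); ring.
have P3' : c3 P = - c1 S * (2%:R * a32 R * a21 S - a32 S * a21 R).
  apply: (mulfI a41n0); have := a41P F rels.
  rewrite (a42Q F rels) r43 (a31Q F rels) => H.
  apply: (lincomb_eq2 (c3 P)
    (2%:R * a32 R * a21 S - a32 S * a21 R) H (esym (a43E S))); ring.
have S1 : c1 S != 0 by apply: contraNneq P3n0 => S1; rewrite P3 S1 mul0r.
have q31 : a31 Q = 0.
  apply/eqP; have : 3%:R * (c1 S * a31 Q) = 0.
    by rewrite (a31Q F rels); apply: (lincomb_eq2 1 (-1) P3' P3); ring.
  by move/eqP; rewrite !mulf_eq0 (negPf three_neq0) (negPf S1).
have r3221 : a32 R * a21 R = 0.
  have /eqP := c3_QR F rels; rewrite q31 mul0r Q2 eq_sym mulrA mulf_eq0.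
  by rewrite (negPf S1) orbF => /eqP.
have := a31Q F rels; rewrite q31 => q31'.
case/eqP: P3n0; rewrite P3; move/eqP: r3221; rewrite mulf_eq0 => /orP[]/eqP r0.
  by move: q31'; rewrite r0 !mul0r sub0r => /eqP;
    rewrite eq_sym oppr_eq0 -mulrA => /eqP ->; ring.
by move: q31'; rewrite r0 !mulr0 !subr0 => <-; ring.
Qed.

(** With S in the kernel of c1 the same entries yield 3 * a31 Q = 0, while
    a41 P = a43 R * a32 S * a21 S keeps the three factors nonzero; the other
    entries follow. *)
Lemma rigidity : c1 S = 0 -> [/\ a31 Q = 0, a21 R = 0 & c2 Q != 0].
Proof.
move=> S1; have R1 := c1R_neq0.
have s43 : a43 S = 0.
  by apply/eqP; have /eqP := a43E S; rewrite S1 mulr0 mulf_eq0 (negPf P3n0) orbF.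
have r43 : a43 R != 0.
  apply: contraTneq (mulf_neq0 a41n0 R1) => r43.
  by rewrite -a43E r43 mul0r negbK.
have yE := a41P F rels; rewrite s43 mul0r subr0 in yE.
have s21 : a21 S != 0 by apply: contraNneq a41n0 => s0; rewrite yE s0 mulr0.
have q42 : a42 Q != 0 by apply: contraNneq a41n0 => q0; rewrite yE q0 mul0r.
have Q42 := a42Q F rels; rewrite s43 mul0r subr0 in Q42.
have s32 : a32 S != 0 by apply: contraNneq q42 => s0; rewrite Q42 s0 mulr0.
have Q2 : c2 Q = - (a21 S * c1 R).
  have := c2_RS F rels; rewrite S1 mulr0 => H.
  by apply: (lincomb_eq (-1) H); ring.
have q31 : a31 Q = - (a32 R * a21 S).
  apply: (mulIf R1); have := c3_QR F rels; rewrite Q2 => H.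
  by apply: (lincomb_eq 1 H); ring.
have q31' : a31 Q = a32 S * a21 R.
  apply: (mulfI r43); rewrite -(a41_QR F rels) Q42; ring.
have Q31 : a31 Q = 0.
  apply/eqP; have : 3%:R * a31 Q = 0.
    have H := a31Q F rels.
    have H2 : 2%:R * a31 Q = a32 R * a21 S by rewrite mulr_natl mulr2n {1}H -q31' subrK.
    by apply: (lincomb_eq2 1 1 H2 q31); ring.
  by move/eqP; rewrite mulf_eq0 (negPf three_neq0).
split=> //; last by rewrite Q2 oppr_eq0 mulf_neq0.
by apply/eqP; move/eqP: q31'; rewrite Q31 eq_sym mulf_eq0 (negPf s32).
Qed.

End CenterEntries.

(** S may be moved into the last term of the flag by factors from <P, Q, R>,
    which clear one coordinate after the other. *)
Lemma flag_generator S : XV_relations p P Q R S ->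
  exists S', XV_relations p P Q R S' /\ [/\ c1 S' = 0, c2 S' = 0 & c3 S' = 0].
Proof.
move=> rels; have expA x := flag_exponent p_pr F x p_gt3.
have [_ QR _ PQ PR _ _ _ _ _] := rels.
have natF (t : 'F_p) : (val t)%:R = t by rewrite natr_Zp.
have c1X x n : c1 (x ^+ n)%g = n%:R * c1 x.
  elim: n => [|n IH]; first by rewrite expg0 brace_one flag0 mul0r.
  by rewrite expgS flagM IH -natr1; ring.
have c2QX n : c2 (Q ^+ n)%g = n%:R * c2 Q.
  elim: n => [|n IH]; first by rewrite expg0 brace_one flag0 mul0r.
  by rewrite expgS flagM IH (entriesQ F rels) -natr1; ring.
have c3PX n : c3 (P ^+ n)%g = n%:R * c3 P.
  elim: n => [|n IH]; first by rewrite expg0 brace_one flag0 mul0r.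
  by rewrite expgS flagM IH !(entriesP F rels) -natr1; ring.
have R1 := c1R_neq0 rels.
pose S1 := (S ∘ R ^+ val (- c1 S / c1 R)%R)%g.
have rels1 : XV_relations p P Q R S1.
  apply: XV_relations_mulS => //; exact: commuteX.
have S11 : c1 S1 = 0 by rewrite flagM c1X natF divfK // subrr.
have [_ _ Q2] := rigidity rels1 S11.
pose S2 := (S1 ∘ Q ^+ val (- c2 S1 / c2 Q)%R)%g.
have rels2 : XV_relations p P Q R S2.
  by apply: XV_relations_mulS => //; apply: commuteX.
have S21 : c1 S2 = 0 by rewrite flagM c1X S11 (entriesQ F rels) mulr0 addr0.
have S22 : c2 S2 = 0.
  by rewrite flagM c2QX natF divfK // c1X (entriesQ F rels) !mulr0 subrr addr0.
pose S3 := (S2 ∘ P ^+ val (- c3 S2 / c3 P)%R)%g.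
exists S3; split; first by apply: XV_relations_mulS => //; apply: commuteX.
have P1 n : c1 (P ^+ n)%g = 0 by rewrite c1X (entriesP F rels) mulr0.
have P2 n : c2 (P ^+ n)%g = 0.
  elim: n => [|n IH]; first by rewrite expg0 brace_one flag0.
  by rewrite expgS flagM IH !(entriesP F rels); ring.
split; rewrite flagM ?P1 ?P2 ?S21 ?S22 ?mulr0 ?addr0 //.
by rewrite c3PX natF divfK ?subrr // (c3P_neq0 rels).
Qed.

End FaithfulCenter.

(** * Recognising the constructed brace *)

(** The linear parts of the matrices lamP, lamQ, lamR, lamS, minus the
    identity, in the basis R, Q, P, S. *)
Record XV_table (p : nat) (A : fpBraceType p) (i k y : 'F_p) (P Q R S : A) : Prop := {
  tab_PR : P ⋆ R = y *: S; tab_PQ : P ⋆ Q = 0; tab_PP : P ⋆ P = 0; tab_PS : P ⋆ S = 0;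
  tab_QR : Q ⋆ R = (2^-1 * y) *: S; tab_QQ : Q ⋆ Q = - (y *: S);
  tab_QP : Q ⋆ P = 0; tab_QS : Q ⋆ S = 0;
  tab_RR : R ⋆ R = i *: P + k *: S; tab_RQ : R ⋆ Q = (2^-1 * y) *: S;
  tab_RP : R ⋆ P = y *: S; tab_RS : R ⋆ S = 0;
  tab_SR : S ⋆ R = - Q + P - (2^-1 * y) *: S; tab_SQ : S ⋆ Q = - P;
  tab_SP : S ⋆ P = 0; tab_SS : S ⋆ S = 0
}.

Section Transport.
Variables (p : nat) (p_pr : prime p) (p_gt3 : (3 < p)%N) (G : groupXV p).
Variables (A : fpBraceType p) (i k y : 'F_p) (P Q R S : A).
Hypotheses (rels : XV_relations p P Q R S) (tab : XV_table i k y P Q R S).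

Let tau (v : 'cV['F_p]_5) : A :=
  v 1 0 *: R + v 2 0 *: Q + v 3 0 *: P + v 4 0 *: S.

Let tauD u v : tau (u + v) = tau u + tau v.
Proof.
rewrite /tau !mxE !scalerDl.
by rewrite [LHS](AC (2*2*2*2) (1*3*5*7*(2*4*6*8))).
Qed.

Let tauZ c v : tau (c *: v) = c *: tau v.
Proof. by rewrite /tau !mxE !scalerDr !scalerA. Qed.

(* M is the affine map (t, v) |-> (t, t a + v + a ⋆ v) of F_p + A, read in
   coordinates. *)
Let affine (M : 'M['F_p]_5) (a : A) := forall v,
  (M *m v) 0 0 = v 0 0 /\ tau (M *m v) = v 0 0 *: a + tau v + a ⋆ tau v.

Let affine1 : affine 1%:M 1%g.
Proof. by move=> v; rewrite mul1mx brace_one scaler0 add0r star0l addr0. Qed.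

Let affineM M N a b : affine M a -> affine N b -> affine (M *m N) (a ∘ b).
Proof.
move=> Ma Nb v; rewrite -mulmxA; have [M0 ->] := Ma (N *m v).
have [N0 ->] := Nb v; rewrite M0 N0; split=> //.
rewrite starMl brace_mulE !starDr !starZr !scalerDr.
by rewrite [LHS](AC (1*3*3) (1*2*5*3*(6*4*7))).
Qed.

Let affineX M a n : affine M a -> affine (M ^+ n) (a ^+ n)%g.
Proof.
move=> Ma; elim: n => [|n IH]; first by rewrite expr0 expg0; exact: affine1.
by rewrite exprS expgS; apply: affineM.
Qed.

Let tau_bas : (tau (bas1 p) = 0) * (tau (basR p) = R) * (tau (basQ p) = Q)
  * (tau (basP p) = P) * (tau (basS p) = S).
Proof.
do ![split]; rewrite /tau !mxE /= ?scale0r ?scale1r ?addr0 ?add0r //.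
Qed.

Let bas_coord0 : (bas1 p 0 0 = 1) * (basR p 0 0 = 0) * (basQ p 0 0 = 0)
  * (basP p 0 0 = 0) * (basS p 0 0 = 0).
Proof. by do ![split]; rewrite mxE. Qed.

Let tauN v : tau (- v) = - tau v.
Proof. by rewrite -scaleN1r tauZ scaleN1r. Qed.

Let affine_lin_of_images a (v1 vR vQ vP vS : 'cV_5) :
  [/\ v1 0 0 = 1, vR 0 0 = 0, vQ 0 0 = 0, vP 0 0 = 0 & vS 0 0 = 0] ->
  tau v1 = a -> tau vR = R + a ⋆ R -> tau vQ = Q + a ⋆ Q ->
  tau vP = P + a ⋆ P -> tau vS = S + a ⋆ S ->
  affine (lin_of_images v1 vR vQ vP vS) a.
Proof.
move=> [h1 hR hQ hP hS] t1 tR tQ tP tS v; rewrite lin_of_imagesE; split.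
  by rewrite !mxE h1 hR hQ hP hS; ring.
rewrite !tauD !tauZ t1 tR tQ tP tS [tau v]/(_ + _ + _ + _) !starDr !starZr !scalerDr.
by rewrite [LHS](AC (1*2*2*2*2) (1*(2*4*6*8)*(3*5*7*9))).
Qed.

Let affine_gens : [/\ affine (lamP y) P, affine (lamQ y) Q,
  affine (lamR i k y) R & affine (lamS y) S].
Proof.
case: tab => PR PQ PP PS QR QQ QP QS RR RQ RP RS SR SQ SP SS.
split; apply: affine_lin_of_images; try (split; rewrite !mxE /=; ring);
  rewrite ?(tauD, tauN, tauZ) ?tau_bas ?addr0 //
    ?(PR, PQ, PP, PS, QR, QQ, QP, QS, RR, RQ, RP, RS, SR, SQ, SP, SS)
    ?addr0 ?addrA //.
Qed.

Let p_gt0 := prime_gt0 p_pr.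

(** The matrices lambda (g) and the affine maps v |-> g ∘ v agree on
    generators, hence everywhere; evaluating both at the origin shows that the
    homomorphism G -> A given by the generators is tau \o XV_f, which is
    additive by definition of the addition of G. *)
Lemma XV_table_hom : {l : G -> A | {morph l : g h / g ∘ h} &
  forall g, l g = tau (XV_f p_pr p_gt3 i k y g)}.
Proof.
have [l lM lnf] := XV_hom_sig p_gt0 G rels; exists l => // g.
have [a [b [c [d [_ _ _ _ ->]]]]] := XV_normal_form p_gt0 g.
rewrite /XV_f (lambda_spec_nf _ _ _ _ (lambdaP p_pr p_gt3 G i k y)) lnf.
have [aP aQ aR aS] := affine_gens.
have : affine (lamS y ^+ a *m lamR i k y ^+ b *m lamQ y ^+ c *m lamP y ^+ d)
  (normal_form P Q R S a b c d) by do !apply: affineM; apply: affineX.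
move=> /(_ (bas1 p))[_]; rewrite bas_coord0 !tau_bas scale1r addr0 star0r addr0.
by rewrite tauD tauN tau_bas subr0 => ->.
Qed.

Lemma brace_isomorphic_of_table (phi : A -> G) : bijective phi ->
  (forall a b c d, a *: R + b *: Q + c *: P + d *: S = 0 ->
    [/\ a = 0, b = 0, c = 0 & d = 0]) ->
  brace_isomorphic A (brace_XV p_pr p_gt3 G i k y).
Proof.
move=> phi_bij indep; have [l lM lE] := XV_table_hom.
have l_inj : injective l.
  move=> g h; rewrite !lE => /eqP; rewrite -subr_eq0 -tauN -tauD.
  move=> /eqP/indep[d1 d2 d3 d4]; apply: (@XV_f_inj _ p_pr p_gt3 _ i k y).
  apply/eqP; rewrite -subr_eq0; set u := _ - _ in d1 d2 d3 d4 *.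
  have /eqP u0 : u 0 0 == 0 by rewrite -XV_BE memvB // XV_f_in.
  apply/eqP/colP => r; rewrite [RHS]mxE; case: r => [[|[|[|[|[|//]]]]] lt];
    [rewrite -u0 | rewrite -d1 | rewrite -d2 | rewrite -d3 | rewrite -d4];
    by congr (u _ _); apply: val_inj.
have l_bij : bijective l.
  have [psi psiK phiK] := phi_bij.
  have /injF_bij[m lm ml] : injective (phi \o l).
    by apply: inj_comp => //; apply: bij_inj.
  exists (m \o phi) => [g /=|a /=]; first exact: lm.
  by apply: (bij_inj phi_bij); apply: ml.
have [m lm ml] := l_bij; exists m; split; first by exists l.
- move=> a b; apply: (bij_inj l_bij); rewrite ml.
  rewrite brace_XV_addE lE XV_finvK; last by apply: memvD; apply: XV_f_in.
  by rewrite tauD -!lE !ml.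
by move=> a b; apply: (bij_inj l_bij); rewrite ml brace_XV_mulE lM !ml.
Qed.

End Transport.

(** * The multiplication table of ⋆ *)

Section Table.
Variables (p : nat) (p_pr : prime p) (p_gt3 : (3 < p)%N) (A : fpBraceType p).
Variables (F : flag A) (P Q R S : A).
Hypothesis rels : XV_relations p P Q R S.
Hypotheses (Pc : forall x, P ∘ x = x ∘ P) (a41n0 : a41 F P != 0).
Local Notation c1 := (c1 F). Local Notation c2 := (c2 F).
Local Notation c3 := (c3 F). Local Notation c4 := (c4 F).
Hypotheses (S1 : c1 S = 0) (S2 : c2 S = 0) (S3 : c3 S = 0).

Let two_neq0 : 2%:R != 0 :> 'F_p.
Proof. by rewrite -(dvdn_pcharf (pchar_Fp p_pr)) gtnNdvd // ltnW. Qed.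

Let S4 : c4 S != 0.
Proof.
apply: contraNneq a41n0 => S4.
have S0 : S = 1%g.
  by rewrite brace_one; apply: (flag_ext (F := F)); rewrite flag0.
have P0 : P = 0.
  have := rel_QS rels; rewrite S0 mulg1 mul1g -[LHS]mulg1 => /mulgI <-.
  by rewrite brace_one.
by rewrite /a41 P0 star0l flag0.
Qed.

Let lineS v : c1 v = 0 -> c2 v = 0 -> c3 v = 0 -> v = (c4 v / c4 S) *: S.
Proof.
move=> v1 v2 v3; apply: (flag_ext (F := F)); rewrite flagZ ?S1 ?S2 ?S3 ?mulr0 //.
by rewrite divfK.
Qed.

Let starS x : x ⋆ S = 0.
Proof. by apply: (flag_ext (F := F)); rewrite flag_star ?S1 ?S2 ?S3 flag0; ring. Qed.

Let y := a41 F P * c1 R / c4 S.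

Let starPl b : P ⋆ b = (a41 F P * c1 b / c4 S) *: S.
Proof.
rewrite [LHS]lineS ?flag_star ?(entriesP F rels) //; try ring.
by congr (_ / _ *: _); ring.
Qed.

(** Triangularity and the vanishing entries give every product except S ⋆ Q and
    S ⋆ R up to scalars i, k, t, u; read as identities between vectors, the
    relations give those two, and read as identities between operators they
    determine t and u. *)
Lemma table_exists : exists i k : 'F_p, XV_table i k y P Q R S.
Proof.
have [q31 r21 Q2] := rigidity p_pr p_gt3 Pc a41n0 rels S1.
have P3 := c3P_neq0 Pc a41n0 rels.
have [QS QR PS PQ PR RS _ _ _ _] := rels.
have Pstar b : c1 b = 0 -> P ⋆ b = 0.
  by move=> b1; rewrite starPl b1 mulr0 mul0r scale0r.
have PRE : P ⋆ R = y *: S by rewrite starPl.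
have PQE : P ⋆ Q = 0 by rewrite Pstar ?(entriesQ F rels).
have PPE : P ⋆ P = 0 by rewrite Pstar ?(entriesP F rels).
have PSE : P ⋆ S = 0 by rewrite Pstar.
have QPE : Q ⋆ P = 0 by rewrite -(star_commute PQ).
have RPE : R ⋆ P = y *: S by rewrite -(star_commute PR).
have SPE : S ⋆ P = 0 by rewrite -(star_commute PS).
pose t := c4 (Q ⋆ R) / c4 S; pose u := c4 (Q ⋆ Q) / c4 S.
have QRE : Q ⋆ R = t *: S.
  by apply: lineS; rewrite flag_star ?q31 ?(entriesQ F rels); ring.
have QQE : Q ⋆ Q = u *: S.
  by apply: lineS; rewrite flag_star ?q31 ?(entriesQ F rels); ring.
have RQE : R ⋆ Q = t *: S by rewrite -(star_commute QR).
pose i := c3 (R ⋆ R) / c3 P; pose k := (c4 (R ⋆ R) - i * c4 P) / c4 S.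
have RRE : R ⋆ R = i *: P + k *: S.
  apply: (flag_ext (F := F)); rewrite !(flagD F (i *: P)) !flagZ.
  - by rewrite flag_star S1 !(entriesP F rels); ring.
  - by rewrite flag_star r21 S2 !(entriesP F rels); ring.
  - by rewrite S3 mulr0 addr0 divfK.
  by rewrite /k divfK // addrC subrK.
have SQE : S ⋆ Q = - P.
  have := star_commutator QS; rewrite starMl SPE QPE starS star0r !addr0.
  by move=> /eqP; rewrite eq_sym addr_eq0 => /eqP.
have SRE : S ⋆ R = - Q + P - t *: S.
  have := star_commutator RS; rewrite starMl SQE RQE starZr !starS scaler0 addr0.
  move=> /eqP; rewrite eq_sym -addrA addr_eq0 => /eqP ->.
  by rewrite !opprD opprK addrA.
(* The relation between R and S acting on Q *)
have uE : u = - y.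
  have := starMl R S Q; rewrite RS starMl (starMl S R) QQE !starZr !starS SQE RQE.
  rewrite starNr RPE starZr starS !scaler0 !addr0 => /(congr1 c4).
  rewrite !(flagD, flagN, flagZ) => H; apply: (mulIf S4).
  by apply: (lincomb_eq 1 H); ring.
(* The relation between R and S acting on R *)
have tE : t = 2^-1 * y.
  have := starMl R S R; rewrite RS starMl (starMl S R) QRE !starZr !starS SRE RRE.
  rewrite !starDr !starNr !starZr RQE RPE SPE !starS !scaler0 => /(congr1 c4).
  rewrite !(flagD, flagN, flagZ) !flag0 => H; apply: (mulIf (mulf_neq0 two_neq0 S4)).
  apply: (lincomb_eq 1 H); field; exact: two_neq0.
exists i, k; split; rewrite ?starS // -?tE //.
by rewrite QQE uE scaleNr.
Qed.

Lemma table_y_neq0 : y != 0.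
Proof.
by rewrite /y !mulf_neq0 ?invr_eq0 // (c1R_neq0 p_pr p_gt3 Pc a41n0 rels).
Qed.

Lemma table_independent a b c d : a *: R + b *: Q + c *: P + d *: S = 0 ->
  [/\ a = 0, b = 0, c = 0 & d = 0].
Proof.
have [q31 r21 Q2] := rigidity p_pr p_gt3 Pc a41n0 rels S1.
have P3 := c3P_neq0 Pc a41n0 rels; have R1 := c1R_neq0 p_pr p_gt3 Pc a41n0 rels.
have z0 (s t : 'F_p) : t != 0 -> s * t = 0 -> s = 0.
  by move=> tn0 /eqP; rewrite mulf_eq0 (negPf tn0) orbF => /eqP.
have E := (flagD, flagZ, entriesP F rels, entriesQ F rels, S1, S2, S3, flag0).
move=> H; have a0 : a = 0.
  by have := congr1 c1 H; rewrite !E !mulr0 !addr0 => /(z0 _ _ R1).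
have b0 : b = 0.
  by have := congr1 c2 H; rewrite !E a0 !mulr0 mul0r add0r !addr0 => /(z0 _ _ Q2).
have c0 : c = 0.
  by have := congr1 c3 H; rewrite !E a0 b0 !mulr0 !mul0r !add0r !addr0 => /(z0 _ _ P3).
by split=> //; have := congr1 c4 H; rewrite !E a0 b0 c0 !mul0r !add0r => /(z0 _ _ S4).
Qed.

End Table.

(** * The classification *)

Theorem theorem6p3 (p : nat) (p_pr : prime p) (p_gt3 : (3 < p)%N)
    (G : groupXV p) (A : fpBraceType p) :
  ~ right_nilpotent A ->
  group_isomorphic A G ->
  exists i k y : 'F_p,
    y != 0 /\ brace_isomorphic A (brace_XV p_pr p_gt3 G i k y).
Proof.
move=> nnil [phi [phi_bij phiM]]; have [psi phiK psiK] := phi_bij.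
have p_gt0 := prime_gt0 p_pr.
have gensG : XV_generators p (XV_P G) (XV_Q G) (XV_R G) (XV_S G).
  split; first exact: XV_rel.
  move=> g; have [a [b [c [d [_ _ _ _ E]]]]] := XV_normal_form p_gt0 g.
  by exists a, b, c, d.
have gens := XV_generators_iso phiM phiK psiK gensG.
have Pc := gen_central p_gt0 gens; have rels := gen_rel gens.
have P0 : psi (XV_P G) != 0.
  apply: contraNneq (XV_P_neq1 p_pr p_gt3 G) => P0; rewrite -(psiK (XV_P G)) P0.
  by apply/eqP/(mulgI (phi 0)); rewrite -phiM -brace_one !mulg1.
have [F] := flag_inhabited p_pr phi_bij (XV_card G) gens.
have [a41P|a41P] := eqVneq (a41 F (psi (XV_P G))) 0.
  have Pstar b : psi (XV_P G) ⋆ b = 0.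
    by apply: (flag_ext (F := F)); rewrite flag_star ?flag0 ?a41P ?(entriesP F rels); ring.
  have [x|F' eP] := flag_exists p_pr phi_bij (XV_card G) gens P0.
    by rewrite -(star_commute (Pc x)).
  by case: nnil; apply: (right_nilpotent_socle p_pr (ltnW p_gt3) gens eP Pstar).
have [S' [rels' [S1 S2 S3]]] := flag_generator p_pr p_gt3 Pc a41P rels.
have [i [k tab]] := table_exists p_pr p_gt3 rels' Pc a41P S1 S2 S3.
exists i, k; eexists; split; last first.
  apply: (brace_isomorphic_of_table p_pr p_gt3 rels' tab phi_bij).
  exact: (table_independent p_pr p_gt3 rels' Pc a41P S1 S2 S3).
exact: (table_y_neq0 p_pr p_gt3 rels' Pc a41P S1 S2 S3).
Qed.
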